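(* Let $k$ be an algebraically closed field, let $X$ be a connected algebraic variety over $k$, and let $\pi:E\to X$ be a vector bundle on $X$. Let $F$ be a closed subvariety of $E$ such that the fibres $F_x = F\cap E_x$ (where $E_x=\pi^{-1}(x)$) are vector subspaces of $E_x$ of constant dimension for all $x\in X$. Then $F$ is a sub-bundle of $E$ if and only if for all $x\in X$ the natural scheme structure on $F_x$, as the scheme-theoretic intersection $F\cap E_x$ of varieties inside $E$, or equivalently as the scheme-theoretic fibre $(\pi|_F)^{-1}(x)$, is reduced.
   Context: Varieties over the algebraically closed field $k$ are reduced and not necessarily irreducible; points $x\in X$ mean closed points. A closed subvariety is a closed subset with its reduced structure. A vector bundle of rank $n$ on $X$ is a variety $E$ equipped with a morphism $\pi:E\to X$ and the structure of an $n$-dimensional $k$-vector space on each fibre $E_x=\pi^{-1}(x)$, such that each $x\in X$ has an open neighbourhood $U$ for which there is an isomorphism $\phi:\pi^{-1}(U)\to U\times k^n$ with $p\circ\phi=\pi$ on $\pi^{-1}(U)$ (where $p:U\times k^n\to U$ is the projection) and with $\phi$ inducing linear maps on the fibres over $U$. A sub-bundle of $E$ is a closed subvariety $F$ of $E$ whose fibres $F_x=F\cap E_x$ are vector subspaces of $E_x$ for all $x\in X$, and such that $F$, equipped with $\pi|_F:F\to X$ and the induced vector space structures on its fibres, is locally trivial, meaning that each $x\in X$ has an open neighbourhood $U$ for which there are an integer $d\ge 0$ and an isomorphism $\psi:(\pi|_F)^{-1}(U)\to U\times k^d$ with $q\circ\psi=\pi|_F$ on $(\pi|_F)^{-1}(U)$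 (where $q:U\times k^d\to U$ is the projection) and with $\psi$ inducing linear maps on the fibres over $U$; hence $F$ is a vector bundle. The hypothesis that the $F_x$ are vector subspaces of constant dimension concerns only the underlying sets of points; the scheme-theoretic fibre of $F$ over $x$ may be non-reduced. *)

(* Defs.v *)
From HB Require Import structures.
From mathcomp Require Import all_boot all_order all_algebra.
From mathcomp Require Import all_classical topology.
(* Importing the notations of mpoly would clash with those of topology. *)
From mathcomp Require mpoly.
Export -(notations) mpoly.

Set Implicit Arguments.
Unset Strict Implicit.
Unset Printing Implicit Defensive.
Import GRing.Theory.
Local Open Scope classical_set_scope.
Local Open Scope ring_scope.

(* Varieties over an algebraically closed field k are treated classically: the
   points are the closed points, and the (reduced) structure sheaf is a sheaf
   of k-valued functions.

   [regular U f] reads f|_U \in O(U); f is a total function of which only the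
   values on the open set U matter. *)
Record fspace (k : closedFieldType) := FSpace {
  fspace_top :> topologicalType;
  regular : set fspace_top -> (fspace_top -> k) -> Prop;
  regular_sub : forall U V f,
    open V -> V `<=` U -> regular U f -> regular V f;
  regular_glue : forall U f, open U ->
    (forall x, U x -> exists V g,
      [/\ open V, V x, V `<=` U, regular V g & forall y, V y -> f y = g y]) ->
    regular U f;
  regular_cst : forall U c, open U -> regular U (fun=> c);
  regularD : forall U f g, open U ->
    regular U f -> regular U g -> regular U (fun x => f x + g x);
  regularM : forall U f g, open U ->
    regular U f -> regular U g -> regular U (fun x => f x * g x);
  regularV : forall U f, open U -> regular U f ->
    (forall x, U x -> f x != 0) -> regular U (fun x => (f x)^-1);
  regular_open : forall U f, open U -> regular U f ->
    open [set x | U x /\ f x != 0]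
}.

Section Morphisms.
Variable k : closedFieldType.
Implicit Types X Y : fspace k.

Definition morphism X Y (f : X -> Y) :=
  continuous f /\
  (forall V g, open V -> regular V g -> regular (f @^-1` V) (g \o f)).

Definition isomorphism X Y (f : X -> Y) :=
  morphism f /\ exists g : Y -> X, [/\ morphism g, cancel f g & cancel g f].

End Morphisms.

(* The structure induced on a subset: the subspace topology, and the functions
   which are locally restrictions of regular functions of the ambient space.
   For A closed this is the reduced structure on A. *)
Section Subspace.
Variables (k : closedFieldType) (X : fspace k) (A : set X).

Definition sub_regular (W : set A) (f : A -> k) :=
  forall w, W w -> exists U g,
    [/\ open U, U (set_val w), regular U g &
        forall v : A, W v -> U (set_val v) -> f v = g (set_val v)].

Lemma open_setval (U : set X) : open U -> open (set_val @^-1` U : set A).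
Proof. by move=> oU; exists U. Qed.

Fact sub_regular_sub U V f :
  open V -> V `<=` U -> sub_regular U f -> sub_regular V f.
Proof.
move=> _ VU rf w /VU /rf [U' [g [oU Uw rg fg]]].
by exists U', g; split=> // v /VU; exact: fg.
Qed.

Fact sub_regular_glue U f : open U ->
  (forall x, U x -> exists V g,
     [/\ open V, V x, V `<=` U, sub_regular V g & forall y, V y -> f y = g y]) ->
  sub_regular U f.
Proof.
move=> _ H w /H [_ [g [[V oV <-] /= Vw VU rg fg]]].
have [U' [h [oU' U'w rh gh]]] := rg w Vw.
exists (U' `&` V), h; split=> //; first exact: openI.
  by apply: regular_sub rh; [exact: openI|exact: subIsetl].
by move=> v _ [U'v Vv]; rewrite fg // gh.
Qed.

Fact sub_regular_cst U c : open U -> sub_regular U (fun=> c).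
Proof.
move=> _ w _; exists setT, (fun=> c); split=> //; first exact: openT.
exact/regular_cst/openT.
Qed.

Let sub_regular2 (op : k -> k -> k) U f g :
  (forall (V : set X) a b, open V -> regular V a -> regular V b ->
    regular V (fun x => op (a x) (b x))) ->
  sub_regular U f -> sub_regular U g -> sub_regular U (fun x => op (f x) (g x)).
Proof.
move=> opP rf rg w Uw.
have [V [a [oV Vw ra fa]]] := rf w Uw; have [W [b [oW Ww rb gb]]] := rg w Uw.
exists (V `&` W), (fun x => op (a x) (b x)); split=> //; first exact: openI.
  apply: opP; first exact: openI.
    by apply: regular_sub ra; [exact: openI|exact: subIsetl].
  by apply: regular_sub rb; [exact: openI|exact: subIsetr].
by move=> v Uv [Vv Wv]; rewrite fa // gb.
Qed.

Fact sub_regularD U f g : open U ->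
  sub_regular U f -> sub_regular U g -> sub_regular U (fun x => f x + g x).
Proof. by move=> _; apply: sub_regular2 => V a b; exact: regularD. Qed.

Fact sub_regularM U f g : open U ->
  sub_regular U f -> sub_regular U g -> sub_regular U (fun x => f x * g x).
Proof. by move=> _; apply: sub_regular2 => V a b; exact: regularM. Qed.

Fact sub_regularV U f : open U -> sub_regular U f ->
  (forall x, U x -> f x != 0) -> sub_regular U (fun x => (f x)^-1).
Proof.
move=> _ rf f0 w Uw; have [V [a [oV Vw ra fa]]] := rf w Uw.
have oW := regular_open oV ra.
exists [set x | V x /\ a x != 0], (fun x => (a x)^-1); split=> //.
- by split=> //; rewrite -fa // f0.
- apply: regularV => // [|x []//].
  by apply: regular_sub ra => // x [].
- by move=> v Uv [Vv _]; rewrite fa.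
Qed.

Fact sub_regular_open U f : open U -> sub_regular U f ->
  open [set x | U x /\ f x != 0].
Proof.
move=> oU rf; rewrite openE => w [Uw fw0].
have [V [a [oV Vw ra fa]]] := rf w Uw.
have /open_setval oW := regular_open oV ra.
rewrite /interior nbhsE.
exists (U `&` set_val @^-1` [set x | V x /\ a x != 0]).
  by split; [exact: openI|split=> //; split=> //; rewrite -fa].
by move=> v [Uv [Vv av]]; split=> //; rewrite fa.
Qed.

Definition subsp : fspace k :=
  FSpace sub_regular_sub sub_regular_glue sub_regular_cst sub_regularD
    sub_regularM sub_regularV sub_regular_open.

End Subspace.

(* The space with functions on a set T whose regular functions are, locally,
   the quotients g/h with g, h in a given family of functions: [num S h] means
   that h is one of the given functions defined on S. The sets
   {x \in S | h x != 0} form a basis of the topology. *)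
Record numerators (k : closedFieldType) (T : Type)
    (num : set T -> (T -> k) -> Prop) : Prop := Numerators {
  num_cover : forall x, exists2 S, S x & num S (fun=> 1);
  num_cst : forall S f c, num S f -> num S (fun=> c);
  numD : forall S R f g,
    num S f -> num R g -> num (S `&` R) (fun x => f x + g x);
  numM : forall S R f g,
    num S f -> num R g -> num (S `&` R) (fun x => f x * g x)
}.

Definition quotient_pts (k : closedFieldType) (T : Type)
  (num : set T -> (T -> k) -> Prop) (numP : numerators num) : Type := T.

Section Quotients.
Variables (k : closedFieldType) (T : Type) (num : set T -> (T -> k) -> Prop).
Variable numP : numerators num.
Notation Q := (quotient_pts numP).

HB.instance Definition _ := gen_eqMixin Q.
HB.instance Definition _ := gen_choiceMixin Q.

Definition quotient_open (O : set Q) := forall p, O p -> exists S h,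
  [/\ num S h, S p, h p != 0 & forall q, S q -> h q != 0 -> O q].

Fact quotient_openT : quotient_open setT.
Proof.
move=> p _; have [S Sp num1] := num_cover numP p.
by exists S, (fun=> 1); split=> //; exact: oner_neq0.
Qed.

Fact quotient_openI : setI_closed quotient_open.
Proof.
move=> O O' oO oO' p [/oO [S [h [nh Sp hp hO]]] /oO' [R [g [ng Rp gp gO']]]].
exists (S `&` R), (fun x => h x * g x); split=> //; first exact: numM.
  by rewrite mulf_neq0.
move=> q [Sq Rq]; rewrite mulf_eq0 negb_or => /andP[hq gq].
by split; [exact: hO|exact: gO'].
Qed.

Fact quotient_open_bigU (I : Type) (f : I -> set Q) :
  (forall i, quotient_open (f i)) -> quotient_open (\bigcup_i f i).
Proof.
move=> of_ p [i _ /of_ [S [h [nh Sp hp hO]]]].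
by exists S, h; split=> // q Sq hq; exists i => //; exact: hO.
Qed.

HB.instance Definition _ := isOpenTopological.Build Q
  quotient_openT quotient_openI quotient_open_bigU.

Lemma quotient_openE (O : set Q) : open O = quotient_open O.
Proof. by []. Qed.

Definition quotient_regular (W : set Q) (f : Q -> k) :=
  forall p, W p -> exists S g h,
    [/\ num S g, num S h, S p, h p != 0 &
        forall q, W q -> S q -> h q != 0 -> f q = g q / h q].

Let quotient_open_num S h : num S h -> open [set x : Q | S x /\ h x != 0].
Proof. by move=> nh; rewrite quotient_openE => p [Sp hp]; exists S, h. Qed.

Fact quotient_regular_sub U V f :
  open V -> V `<=` U -> quotient_regular U f -> quotient_regular V f.
Proof.
move=> _ VU rf p /VU /rf [S [g [h [ng nh Sp hp fgh]]]].
by exists S, g, h; split=> // q /VU; exact: fgh.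
Qed.

Fact quotient_regular_glue U f : open U ->
  (forall x, U x -> exists V g, [/\ open V, V x, V `<=` U,
     quotient_regular V g & forall y, V y -> f y = g y]) ->
  quotient_regular U f.
Proof.
move=> _ H p /H [V [f' []]]; rewrite quotient_openE => oV Vp VU rf' ff'.
have [S [g [h [ng nh Sp hp fgh]]]] := rf' p Vp.
have [R [l [nl Rp lp lV]]] := oV p Vp.
exists (S `&` R), (fun x => g x * l x), (fun x => h x * l x).
split=> //; [exact: numM|exact: numM|by rewrite mulf_neq0|].
move=> q _ [Sq Rq]; rewrite mulf_eq0 negb_or => /andP[hq lq].
have Vq := lV q Rq lq.
by rewrite ff' // fgh // invfM mulrACA divff // mulr1.
Qed.

Fact quotient_regular_cst U c : open U -> quotient_regular U (fun=> c).
Proof.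
move=> _ p _; have [S Sp n1] := num_cover numP p.
exists S, (fun=> c), (fun=> 1); split=> //; first exact: num_cst n1.
  exact: oner_neq0.
by move=> q _ _ _; rewrite divr1.
Qed.

Fact quotient_regularD U f g : open U -> quotient_regular U f ->
  quotient_regular U g -> quotient_regular U (fun x => f x + g x).
Proof.
move=> _ rf rg p Up.
have [S [a [b [na nb Sp bp fab]]]] := rf p Up.
have [R [c [d [nc nd Rp dp gcd]]]] := rg p Up.
exists (S `&` R), (fun x => a x * d x + c x * b x), (fun x => b x * d x).
split=> //; last 2 first.
- by rewrite mulf_neq0.
- move=> q Uq [Sq Rq]; rewrite mulf_eq0 negb_or => /andP[bq dq].
  by rewrite fab // gcd // addf_div.
- rewrite -[S `&` R]setIid; apply: numD => //; first exact: numM.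
  by rewrite setIC; apply: numM.
- exact: numM.
Qed.

Fact quotient_regularM U f g : open U -> quotient_regular U f ->
  quotient_regular U g -> quotient_regular U (fun x => f x * g x).
Proof.
move=> _ rf rg p Up.
have [S [a [b [na nb Sp bp fab]]]] := rf p Up.
have [R [c [d [nc nd Rp dp gcd]]]] := rg p Up.
exists (S `&` R), (fun x => a x * c x), (fun x => b x * d x).
split=> //; [exact: numM|exact: numM|by rewrite mulf_neq0|].
move=> q Uq [Sq Rq]; rewrite mulf_eq0 negb_or => /andP[bq dq].
by rewrite fab // gcd // mulf_div.
Qed.

Fact quotient_regularV U f : open U -> quotient_regular U f ->
  (forall x, U x -> f x != 0) -> quotient_regular U (fun x => (f x)^-1).
Proof.
move=> _ rf f0 p Up.
have [S [a [b [na nb Sp bp fab]]]] := rf p Up.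
have ap : a p != 0.
  by apply: contraNneq (f0 p Up) => ap; rewrite fab // ap mul0r.
rewrite -[S]setIid in fab Sp.
exists (S `&` S), (fun x => b x * b x), (fun x => a x * b x).
split=> //; [exact: numM|exact: numM|by rewrite mulf_neq0|].
move=> q Uq Sq; rewrite mulf_eq0 negb_or => /andP[aq bq].
by rewrite fab // invf_div -mulf_div divff // mulr1.
Qed.

Fact quotient_regular_open U f : open U -> quotient_regular U f ->
  open [set x | U x /\ f x != 0].
Proof.
move=> oU rf; rewrite openE => p [Up fp].
have [S [a [b [na nb Sp bp fab]]]] := rf p Up.
have ap : a p != 0.
  by apply: contraNneq fp => ap; rewrite fab // ap mul0r.
rewrite /interior nbhsE.
exists (U `&` ([set x : Q | S x /\ a x != 0] `&`
               [set x : Q | S x /\ b x != 0])); last first.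
  move=> q [Uq [[Sq aq] [_ bq]]]; split=> //.
  by rewrite fab // mulf_neq0 // invr_eq0.
by split=> //; apply: openI => //; apply: openI; exact: quotient_open_num.
Qed.

Definition quotient_space : fspace k :=
  FSpace quotient_regular_sub quotient_regular_glue quotient_regular_cst
    quotient_regularD quotient_regularM quotient_regularV
    quotient_regular_open.

End Quotients.

(* k^n with its Zariski topology; regular functions are locally quotients of
   polynomials. *)
Section AffineSpace.
Variables (k : closedFieldType) (n : nat).

Definition poly_num (S : set 'rV[k]_n) (h : 'rV[k]_n -> k) :=
  S = setT /\ exists p : mpoly n k, forall v, h v = meval (fun i => v 0 i) p.

Fact poly_numP : numerators poly_num.
Proof.
have cstP c : poly_num setT (fun=> c).
  by split=> //; exists (mpolyC n c) => v; rewrite mevalC.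
split=> [x|S f c [-> _]|_ _ f g [-> [p fp]] [-> [q gq]]|
         _ _ f g [-> [p fp]] [-> [q gq]]]; first by exists setT.
- exact: cstP.
- by rewrite setTI; split=> //; exists (p + q) => v; rewrite mevalD fp gq.
- by rewrite setTI; split=> //; exists (p * q) => v; rewrite mevalM fp gq.
Qed.

Definition affine_space : fspace k := quotient_space poly_numP.

End AffineSpace.

(* The product in the category of varieties: locally, the regular functions are
   quotients of functions \sum_i a_i(x) b_i(y) with a_i, b_i regular. Its
   topology is finer than the product topology. *)
Section Product.
Variables (k : closedFieldType) (X Y : fspace k).

Definition tensor_num (S : set (X * Y)) (h : X * Y -> k) :=
  exists (U : set X) (V : set Y),
    [/\ open U, open V, S = U `*` V &
      exists (I : finType) (a : I -> X -> k) (b : I -> Y -> k),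
        [/\ forall i, regular U (a i), forall i, regular V (b i) &
            forall p, S p -> h p = \sum_i a i p.1 * b i p.2]].

Let setXI (U U' : set X) (V V' : set Y) :
  (U `*` V) `&` (U' `*` V') = (U `&` U') `*` (V `&` V').
Proof. by apply/seteqP; split=> -[x y] /= [[? ?] [? ?]]. Qed.

Fact tensor_numP : numerators tensor_num.
Proof.
have cstP (U : set X) (V : set Y) c : open U -> open V ->
    tensor_num (U `*` V) (fun=> c).
  move=> oU oV; exists U, V; split=> //.
  exists unit, (fun _ _ => c), (fun _ _ => 1).
  split=> [_|_|p _]; [exact: regular_cst|exact: regular_cst|].
  by rewrite (big_pred1 tt) ?mulr1 //; case.
split=> [x|S f c [U [V [oU oV -> _]]]|S R f g|S R f g].
- exists setT => //; rewrite -(@setXTT X Y); apply: cstP; exact: openT.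
- exact: cstP.
- move=> [U [V [oU oV -> [I [a [b [ra rb fab]]]]]]].
  move=> [U' [V' [oU' oV' -> [J [c [d [rc rd gcd]]]]]]].
  have oUU' := openI oU oU'; have oVV' := openI oV oV'.
  exists (U `&` U'), (V `&` V'); split=> //.
  exists (I + J)%type, (fun t => match t with inl i => a i | inr j => c j end).
  exists (fun t => match t with inl i => b i | inr j => d j end); split.
  + case=> [i|j]; first by apply: regular_sub (ra i) => //; exact: subIsetl.
    by apply: regular_sub (rc j) => //; exact: subIsetr.
  + case=> [i|j]; first by apply: regular_sub (rb i) => //; exact: subIsetl.
    by apply: regular_sub (rd j) => //; exact: subIsetr.
  + by move=> p [Up U'p]; rewrite big_sumType /= fab // gcd.
- move=> [U [V [oU oV -> [I [a [b [ra rb fab]]]]]]].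
  move=> [U' [V' [oU' oV' -> [J [c [d [rc rd gcd]]]]]]].
  have oUU' := openI oU oU'; have oVV' := openI oV oV'.
  exists (U `&` U'), (V `&` V'); split=> //.
  exists (I * J)%type, (fun t x => a t.1 x * c t.2 x).
  exists (fun t y => b t.1 y * d t.2 y); split.
  + move=> [i j]; apply: regularM => //=.
      by apply: regular_sub (ra i) => //; exact: subIsetl.
    by apply: regular_sub (rc j) => //; exact: subIsetr.
  + move=> [i j]; apply: regularM => //=.
      by apply: regular_sub (rb i) => //; exact: subIsetl.
    by apply: regular_sub (rd j) => //; exact: subIsetr.
  + move=> p [Up U'p]; rewrite fab // gcd // big_distrlr /= pair_big /=.
    by apply: eq_bigr => -[i j] _ /=; rewrite mulrACA.
Qed.

Definition prodsp : fspace k := quotient_space tensor_numP.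

End Product.

Section Varieties.
Variable k : closedFieldType.
Implicit Types X : fspace k.

Definition affine X := exists n (Z : set (affine_space k n)),
  closed Z /\ exists f : X -> subsp Z, isomorphism f.

Definition separated X :=
  closed ([set p | p.1 = p.2] : set (prodsp X X)).

Definition variety X :=
  (exists m (U : 'I_m -> set X),
     [/\ forall i, open (U i), forall i, affine (subsp (U i)) &
         \bigcup_i U i = setT]) /\
  separated X.

End Varieties.

(* A closed subscheme of X is given by an ideal sheaf J; [J U f] reads
   f|_U \in J(U). As the opens (hence the sheaves) of a scheme of finite type
   over k are those of its space of closed points, nothing is lost by working
   on closed points. *)
Section ClosedSubschemes.
Variable k : closedFieldType.
Implicit Types X Y : fspace k.

Definition ideal_sheaf X := set X -> (X -> k) -> Prop.

(* The ideal sheaf of the reduced subscheme A, for A closed. *)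
Definition vanishing X (A : set X) : ideal_sheaf X := fun U f =>
  regular U f /\ (forall x, U x -> A x -> f x = 0).

(* The sheaf sum I + J, which defines the scheme-theoretic intersection of the
   closed subschemes defined by I and J. *)
Definition ideal_add X (I J : ideal_sheaf X) : ideal_sheaf X := fun U f =>
  regular U f /\
  forall x, U x -> exists V a b,
    [/\ open V, V x, V `<=` U, I V a /\ J V b &
        forall y, V y -> f y = a y + b y].

(* The ideal sheaf of O_Y generated by the pullbacks of the sections of J; it
   defines the scheme-theoretic inverse image under f of the closed subscheme
   defined by J. *)
Definition ideal_pullback X Y (f : Y -> X) (J : ideal_sheaf X)
    : ideal_sheaf Y := fun W s =>
  regular W s /\
  forall y, W y -> exists (V : set Y) (U : set X),
    [/\ open V, V y, V `<=` W, open U /\ V `<=` f @^-1` U &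
      exists m (a : 'I_m -> Y -> k) (g : 'I_m -> X -> k),
        [/\ forall i, regular V (a i), forall i, J U (g i) &
            forall z, V z -> s z = \sum_i a i z * g i (f z)]].

(* The scheme-theoretic intersection of two closed subvarieties. *)
Definition scheme_inter X (A B : set X) : ideal_sheaf X :=
  ideal_add (vanishing A) (vanishing B).

(* The scheme-theoretic fibre at a closed point. *)
Definition scheme_fibre X Y (f : Y -> X) (x : X) : ideal_sheaf Y :=
  ideal_pullback f (vanishing [set x]).

(* The structure sheaf O_X/J of the subscheme has no nilpotent sections. A
   section of O_X/J is locally the class of a section of O_X, and J is a sheaf,
   so it suffices to consider classes of sections of O_X. *)
Definition reduced_subscheme X (J : ideal_sheaf X) :=
  forall U f m, open U -> regular U f ->
    J U (fun x => f x ^+ m) -> J U f.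

End ClosedSubschemes.

(* A map of spaces whose fibres are finite-dimensional vector spaces. *)
Record vfamily (k : closedFieldType) (X : fspace k) := VFamily {
  total :> fspace k;
  vproj : total -> X;
  fibre_vect : forall x, Vector k (set_type (vproj @^-1` [set x]))
}.
Arguments vproj {k X} E _ : rename.

Section VectorBundles.
Variables (k : closedFieldType) (X : fspace k).
Implicit Types (E : vfamily X) (U : set X).

Definition vfibre E (x : X) : vectType k := Vector.Pack (fibre_vect E x).

Definition fibre_pt E x (e : vfibre E x) : E :=
  set_val (e : set_type (vproj E @^-1` [set x])).

(* For every x, f is linear on the part of S in the fibre over x. *)
Definition fibre_linear E (S : set E) d (f : S -> 'rV[k]_d) :=
  forall x (c : k) (u v : vfibre E x) (p q r : S),
    set_val p = fibre_pt u -> set_val q = fibre_pt v ->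
    set_val r = fibre_pt (c *: u + v) -> f r = c *: f p + f q.

Definition trivialization E (S : set E) U d
    (f : subsp S -> prodsp (subsp U) (affine_space k d)) :=
  [/\ isomorphism f,
      forall p : S, set_val (f p).1 = vproj E (set_val p) &
      fibre_linear (fun p : S => (f p).2 : 'rV[k]_d)].

Definition vector_bundle n E :=
  [/\ variety E, morphism (vproj E),
      forall x, \dim {:vfibre E x} = n &
      forall x, exists U, [/\ open U, U x &
        exists f : subsp (vproj E @^-1` U) ->
                   prodsp (subsp U) (affine_space k n),
          trivialization f]].

(* The subset F \cap E_x is a vector subspace of E_x of dimension d. *)
Definition fibre_subspace E (F : set E) x d :=
  exists2 V : {vspace vfibre E x}, \dim V = d &
    forall e : vfibre E x, F (fibre_pt e) <-> e \in V.

Definition sub_bundle E (F : set E) :=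
  [/\ closed F, forall x, exists d, fibre_subspace F x d &
      forall x, exists U d, [/\ open U, U x &
        exists f : subsp (F `&` vproj E @^-1` U) ->
                   prodsp (subsp U) (affine_space k d),
          trivialization f]].

Definition restr_proj E (F : set E) : subsp F -> X :=
  fun p => vproj E (set_val p).

End VectorBundles.
Arguments restr_proj {k X E} F _.

(* Main.v *)
Require Import Defs.
From HB Require Import structures.
From mathcomp Require Import all_boot all_order all_algebra.
From mathcomp Require Import all_classical topology.
Set Implicit Arguments.
Unset Strict Implicit.
Unset Printing Implicit Defensive.
Import GRing.Theory.
Local Open Scope classical_set_scope.
Local Open Scope ring_scope.

(** In a local trivialization, a regular function on the total space near a
    point is a quotient of polynomials in the fibre coordinates whose
    coefficients are regular functions on the base.

    If F is locally trivial, subtracting from such a quotient its value on the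
    fibre over x shows that a function vanishing on the fibre lies in the ideal
    generated by the maximal ideal of x, so that the fibre is reduced. The same
    remark applied to E identifies the intersection of F with E_x with the fibre
    of F over x.

    Conversely, let l be a linear form vanishing on the fibre of F over x. The
    values at x of the families of polynomials vanishing on F form an ideal
    whose zero set is that fibre; by the Nullstellensatz it contains a power of
    l, and by reducedness l itself belongs to the ideal of the intersection near
    the origin. As F is a cone, the part of degree one of the family so obtained
    vanishes on F, and at x it is a nonzero multiple of l. Letting l run over a
    basis, one gets n - d linear equations with regular coefficients, independent
    near x; as the fibres have constant dimension d, these define F, which is
    therefore the kernel of a surjective map of trivial bundles. *)

(** * Hilbert's Nullstellensatz *)

Definition is_ideal (A : comNzRingType) (I : A -> Prop) :=
  [/\ I 0, forall a b, I a -> I b -> I (a + b) & forall a b, I b -> I (a * b)].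

Lemma mpoly_rmorph_eq n (R : nzRingType) (S : comNzRingType)
    (f g : {rmorphism mpoly n R -> S}) :
  (forall c, f (mpolyC n c) = g (mpolyC n c)) ->
  (forall i, f (mpolyX R (mnm1 i)) = g (mpolyX R (mnm1 i))) -> f =1 g.
Proof.
move=> fgC fgX p; rewrite (mpolyE p) !rmorph_sum; apply: eq_bigr => m _.
rewrite -mul_mpolyC !rmorphM fgC mpolyXE_id !rmorph_prod; congr (_ * _).
by apply: eq_bigr => i _; rewrite !rmorphXn /= fgX.
Qed.

(** Monic polynomials keep their degrees under [f], so the two Sylvester matrices have the same
    shape and correspond entrywise. *)
Lemma map_resultant_monic (A B : nzRingType) (f : {rmorphism A -> B})
    (p q : {poly A}) : p \is monic -> q \is monic ->
  f (resultant p q) = resultant (map_poly f p) (map_poly f q).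
Proof.
move=> /monicP p1 /monicP q1.
have fp0 : f (lead_coef p) != 0 by rewrite p1 rmorph1 oner_neq0.
have fq0 : f (lead_coef q) != 0 by rewrite q1 rmorph1 oner_neq0.
rewrite /resultant -det_map_mx /Sylvester_mx map_col_mx !size_map_poly_id0 //.
by congr (\det (col_mx _ _)); apply: map_lin1_mx => v;
  rewrite map_poly_rV rmorphM /= map_rVpoly.
Qed.

(** * Extending a zero of the contracted ideal by one coordinate *)

Section ExtendZero.
Variables (k : closedFieldType) (B : comNzRingType) (phi : {rmorphism B -> k}).
Variables (s : k -> B) (I : {poly B} -> Prop).
Hypothesis phiK : cancel s phi.
Hypothesis idI : is_ideal I.
Hypothesis phiI0 : forall b, I b%:P -> phi b = 0.

(* The degree of f may drop under phi; adding a monic multiple of g to f makes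
   the resultant commute with phi. *)
Lemma ideal_image_proper f g :
  I f -> I g -> g \is monic -> map_poly phi f <> 1.
Proof.
case: idI => I0 ID IM If Ig mg f1.
have [g1|g1] := leqP (size g) 1.
  have g1E : g = 1%:P.
    rewrite (size1_polyC g1); congr _%:P.
    by have := mg; rewrite {1}(size1_polyC g1) monicE lead_coefC => /eqP.
  by have := oner_neq0 k; rewrite -(rmorph1 phi) phiI0 ?eqxx // -g1E.
pose f' := 'X^(size f) * g + f.
have g0 : g != 0 by rewrite monic_neq0.
have szXg : size ('X^(size f) * g) = (size f + size g)%N.
  by rewrite size_monicM ?monicXn // size_polyXn addSn.
have lt_f : (size f < size ('X^(size f) * g)%R)%N.
  by rewrite szXg -{1}[size f]addn0 ltn_add2l size_poly_gt0.
have mf' : f' \is monic.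
  by rewrite monicE lead_coefDl // lead_coef_monicM ?monicXn // -monicE.
have f'1 : (1 < size f')%N.
  by rewrite size_polyDl // szXg (leq_trans g1) // leq_addl.
have If' : I f' by apply: ID => //; exact: IM.
(* The resultant is a combination of [f'] and [g], hence a constant in [I], and [phi] kills it: the
   images of [f'] and [g] have a nonconstant common divisor. *)
have [[u v] /= _ ruv] := resultant_in_ideal f'1 g1.
have /phiI0/eqP : I (resultant f' g)%:P by rewrite ruv; apply: ID; exact: IM.
rewrite map_resultant_monic // resultant_eq0.
rewrite /f' rmorphD rmorphM /= f1.
set d := gcdp _ _ => d1.
(* The image of [f'] is 1 plus a multiple of the image of [g]. *)
have : d %| 1.
  rewrite -(dvdp_addr _ (_ : d %| map_poly phi 'X^(size f) * map_poly phi g)).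
    exact: dvdp_gcdl.
  by apply: dvdp_mull; exact: dvdp_gcdr.
by rewrite dvdp1 => /eqP d1'; rewrite d1' in d1.
Qed.

(** The images of the elements of [I] form an ideal of k[X], multipliers being lifted
    coefficientwise by [s]. It is proper by [ideal_image_proper], so a nonzero element of least
    degree has a root, and that element divides all the others. *)
Lemma ideal_common_root g : I g -> g \is monic ->
  exists tau, forall p, I p -> (map_poly phi p).[tau] = 0.
Proof.
case: (idI) => I0 ID IM Ig mg.
pose J q := exists2 p, I p & map_poly phi p = q.
have JM u q : J q -> J (u * q).
  move=> [p Ip <-]; exists (\poly_(i < size u) s u`_i * p); first exact: IM.
  rewrite rmorphM /=; congr (_ * _); apply/polyP => i.
  rewrite coef_map coef_poly; case: ltnP => [_|le]; first exact: phiK.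
  by rewrite raddf0 nth_default.
have JB p q : J p -> J q -> J (p - q).
  move=> [a Ia <-] [b Ib <-]; exists (a - b); last by rewrite rmorphB.
  by apply: ID => //; rewrite -mulN1r; exact: IM.
pose P m := `[< exists q, [/\ J q, q != 0 & size q = m] >].
have exP : exists m, P m.
  exists (size (map_poly phi g)); apply/asboolP; exists (map_poly phi g).
  by split=> //; [exists g | rewrite monic_neq0 ?monic_map].
case: (ex_minnP exP) => m /asboolP[h [Jh h0 szh]] minh.
have [|tau htau] := closed_rootP h _.
  apply/negP; rewrite -[(1%R : nat)]/1%N => /size_poly1P[c c0 hc].
  have : J (c^-1%:P * h) by exact: JM.
  rewrite hc -polyCM mulVf // => -[f If f1].
  exact: (ideal_image_proper If Ig mg f1).
exists tau => p Ip; set q := map_poly phi p.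
have Jq : J (q %% h).
  have -> : q %% h = q - q %/ h * h by rewrite {2}(divp_eq q h) addrC addKr.
  by apply: JB; [exists p|exact: JM].
have [qh0|qh0] := eqVneq (q %% h) 0.
  by rewrite (divp_eq q h) qh0 addr0 hornerM (rootP htau) mulr0.
have := minh (size (q %% h)); rewrite leqNgt -szh ltn_modp h0 => /(_ _)/negP.
by case=> //; apply/asboolP; exists (q %% h).
Qed.

End ExtendZero.

(** Uniqueness of digits in base [E]; in [nagata_monic] it separates the degrees of the images of
    distinct monomials. *)
Lemma digits_inj E n (a b : 'I_n -> nat) :
  (forall i, a i < E)%N -> (forall i, b i < E)%N ->
  (\sum_i a i * E ^ i = \sum_i b i * E ^ i)%N -> a =1 b.
Proof.
elim: n a b => [|n IHn] a b aE bE; first by move=> _ [].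
have shift (c : 'I_n.+1 -> nat) : (\sum_i c i * E ^ i =
    (\sum_(i < n) c (lift ord0 i) * E ^ i) * E + c ord0)%N.
  rewrite big_ord_recl expn0 muln1 addnC; congr (_ + _)%N.
  rewrite big_distrl; apply: eq_bigr => i _ /=.
  by rewrite -mulnA -expnSr.
rewrite !shift => eq_ab.
have E0 : (0 < E)%N by rewrite (leq_trans _ (aE ord0)).
have eq0 : a ord0 = b ord0.
  have := congr1 (modn^~ E) eq_ab.
  by rewrite /= !modnMDl !modn_small.
move: eq_ab; rewrite eq0 => /addIn/eqP; rewrite eqn_pmul2r // => /eqP.
move=> /(IHn (fun i => a (lift ord0 i)) (fun i => b (lift ord0 i))) eqS i.
case: (unliftP ord0 i) => [j|] -> //.
by apply: eqS => l.
Qed.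

(** * Nagata's substitution, weak and strong Nullstellensatz *)

Section Nullstellensatz.
Variable k : closedFieldType.

(* Nagata's change of variables: X_0 is the distinguished variable and
   X_(i.+1) is shifted by X_0 ^ (E ^ i.+1). *)
Definition nagata_shift n E (i : 'I_n.+1) : {poly mpoly n k} :=
  'X^(E ^ i) + (oapp (fun j => mpolyX k (mnm1 j)) 0 (unlift ord0 i))%:P.

Definition nagata n E : mpoly n.+1 k -> {poly mpoly n k} :=
  mmap (polyC \o @mpolyC n k) (nagata_shift E).

(** All exponents in [g] are less than [msize g], so the weights [w m], which are the degrees of the
    images of the monomials, are distinct. A single monomial reaches the highest degree, and its
    coefficient is a scalar. *)
Lemma nagata_monic n (g : mpoly n.+1 k) : g != 0 ->
  exists2 c : k, c != 0 & (mpolyC n c)%:P * nagata (msize g) g \is monic.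
Proof.
move=> g0; set E := msize g.
have E0 : (0 < E)%N by rewrite lt0n msize_poly_eq0.
pose w (m : multinom n.+1) := (\sum_i m i * E ^ i)%N.
have [m0 m0g maxw] : exists2 m0, m0 \in msupp g &
    forall m, m \in msupp g -> (w m <= w m0)%N.
  have : msupp g != [::] by rewrite msupp_eq0.
  elim: (msupp g) => // a [|b s] IHs _.
    by exists a => [|m]; rewrite ?mem_head // mem_seq1 => /eqP->.
  have [//|m0 m0s maxs] := IHs.
  have [wa|wa] := leqP (w a) (w m0).
    exists m0 => [|m]; first by rewrite in_cons m0s orbT.
    by rewrite in_cons => /orP[/eqP->|/maxs].
  exists a => [|m]; first by rewrite mem_head.
  by rewrite in_cons => /orP[/eqP->|/maxs/leq_trans->] //; exact: ltnW.
have digE m i : m \in msupp g -> (m i < E)%N.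
  move=> /msize_mdeg_lt; apply: leq_ltn_trans.
  by rewrite mdegE (bigD1 i) //= leq_addr.
have w_inj m : m \in msupp g -> w m = w m0 -> m = m0.
  by move=> mg eqw; apply/mnmP; apply: (digits_inj _ _ eqw) => i; exact: digE.
have Ei i : (0 < E ^ i)%N by rewrite expn_gt0 E0.
have mon_s (i : 'I_n.+1) : nagata_shift E i \is monic.
  by rewrite monicE lead_coefXnaddC.
have mon_m m : mmap1 (nagata_shift (n := n) E) m \is monic.
  by apply: monic_prod => i _; exact: monic_exp.
have sz_m m : size (mmap1 (nagata_shift (n := n) E) m) = (w m).+1.
  have -> : w m = (size (mmap1 (nagata_shift (n := n) E) m)).-1.
    rewrite /w /mmap1.
    elim: (index_enum _) => [|i s IHs]; first by rewrite !big_nil size_poly1.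
    rewrite !big_cons size_monicM ?monic_exp //; last first.
      by rewrite monic_neq0 // monic_prod // => j _; exact: monic_exp.
    have := size_exp (nagata_shift E i) (m i).
    rewrite {2}/nagata_shift size_XnaddC //= => sze.
    have szi : (0 < size (nagata_shift E i ^+ m i))%N.
      by rewrite size_poly_gt0 monic_neq0 // monic_exp.
    rewrite -(prednK szi) sze addSn /= IHs mulnC.
    have : (0 < size (\prod_(j <- s) nagata_shift E j ^+ m j)%R)%N.
      rewrite size_poly_gt0 monic_neq0 // monic_prod // => j _.
      exact: monic_exp.
    by case: (size _) => // q _; rewrite addnS.
  by rewrite prednK // size_poly_gt0 monic_neq0.
have gm0 : mcoeff m0 g != 0 by rewrite -mcoeff_msupp.
exists (mcoeff m0 g)^-1; first by rewrite invr_eq0.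
have szC (c : k) (m : multinom n.+1) : c != 0 ->
    size ((mpolyC n c)%:P * mmap1 (nagata_shift (n := n) E) m) = (w m).+1.
  by move=> c0; rewrite mul_polyC size_scale ?sz_m // mpolyC_eq0.
rewrite monicE /nagata /mmap (bigD1_seq m0) ?msupp_uniq //= mulrDr.
rewrite lead_coefDl; last first.
  rewrite mul_polyC (leq_ltn_trans (size_scale_leq _ _)) //.
  rewrite mulrA -!polyCM -mpolyCM mulVf // szC ?oner_eq0 // ltnS.
  apply: (leq_trans (size_sum _ _ _)).
  rewrite big_seq_cond; apply/bigmax_leqP_seq => m _ /andP[mg mm0].
  rewrite szC -?mcoeff_msupp // ltn_neqAle maxw // andbT.
  by apply: contraNneq mm0 => /w_inj->.
rewrite mulrA -!polyCM -mpolyCM mulVf // mpolyC1 mul1r.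
exact/eqP/monicP.
Qed.

(* Arrondo's induction: after Nagata's change of variables the ideal contains
   a polynomial monic in X_0, so that a zero of its contraction extends. *)
Theorem weak_nullstellensatz n (I : mpoly n k -> Prop) :
  is_ideal I -> ~ I 1 -> exists v, forall p, I p -> meval v p = 0.
Proof.
elim: n I => [|n IHn] I idI I1; case: (idI) => I0 ID IM.
  exists (fun=> 0) => p Ip; apply: contrapT => /eqP p0; apply: I1.
  have pC : p = mpolyC 0 (mcoeff (@mnm0 0) p).
    apply/mpolyP => m; rewrite mcoeffC.
    have -> : m = (@mnm0 0) by apply/mnmP => -[].
    by rewrite eqxx mulr1.
  rewrite pC mevalC in p0.
  by rewrite -mpolyC1 -(mulVf p0) mpolyCM -pC; exact: IM.
have [[g [Ig g0]]|nog] := pselect (exists g, I g /\ g != 0); last first.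
  exists (fun=> 0) => p Ip; have [->|p0] := eqVneq p 0; first exact: meval0.
  by case: nog; exists p.
set E := msize g.
pose X0 : mpoly n.+1 k := mpolyX k (mnm1 ord0).
(* Applying [th] to the coefficients and putting [X0] for the variable undoes [nagata], as [nagataK]
   shows; [J] is therefore [I] in the new variables. *)
pose th : mpoly n k -> mpoly n.+1 k := mmap (@mpolyC n.+1 k)
  (fun j => mpolyX k (mnm1 (lift ord0 j)) - X0 ^+ (E ^ lift ord0 j)).
pose J q := I (map_poly th q).[X0].
have idJ : is_ideal J.
  split=> [|a b|a b].
  - by rewrite /J rmorph0 horner0.
  - by rewrite /J rmorphD hornerD; exact: ID.
  - by rewrite /J rmorphM hornerM; exact: IM.
have [v Jv] : exists v, forall b, J b%:P -> meval v b = 0.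
  apply: IHn; last by rewrite /J rmorph1 hornerC.
  case: idJ => J0 JD JM; split=> [|a b Ja Jb|a b Jb].
  - by rewrite polyC0.
  - by rewrite polyCD; exact: JD.
  - by rewrite polyCM; exact: JM.
have nagataK p : (map_poly th (nagata E p)).[X0] = p.
  apply: (mpoly_rmorph_eq (f := horner_eval X0 \o map_poly th \o nagata E)
    (g := idfun)) => [c|i] /=; rewrite /horner_eval /nagata.
    by rewrite mmapC /= map_polyC hornerC /= /th mmapC.
  rewrite mmapX mmap1U /nagata_shift rmorphD /= map_polyXn map_polyC.
  rewrite hornerD hornerXn hornerC.
  case: unliftP => [j|] -> /=; last by rewrite /th mmap0 addr0 expn0 expr1.
  by rewrite /th mmapX mmap1U addrC subrK.
have [c c0 monic_g] := nagata_monic g0.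
have Jg : J ((mpolyC n c)%:P * nagata E g).
  by case: idJ => _ _; apply; rewrite /J nagataK.
have [tau Jtau] := ideal_common_root (phi := meval v) (s := @mpolyC n k)
  (@mevalC n k v) idJ Jv Jg monic_g.
(* The zero given by [tau] and [v] is carried back to the old variables by evaluating the shifts at
   it. *)
exists (fun i => (map_poly (meval v) (nagata_shift E i)).[tau]) => p Ip.
rewrite -(Jtau (nagata E p)); last by rewrite /J nagataK.
apply: (mpoly_rmorph_eq (f := meval _)
  (g := horner_eval tau \o map_poly (meval v) \o nagata E)) => [b|i] /=.
  by rewrite /horner_eval /nagata mmapC /= map_polyC hornerC /= !mevalC.
by rewrite /horner_eval /nagata mmapX mmap1U mevalXU.
Qed.

(* Rabinowitsch's trick: the additional variable X_0 stands for 1 / f in the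
   fraction field. *)
Theorem nullstellensatz n (I : mpoly n k -> Prop) (f : mpoly n k) :
  is_ideal I ->
  (forall v, (forall p, I p -> meval v p = 0) -> meval v f = 0) ->
  exists m, I (f ^+ m).
Proof.
move=> idI fI; case: (idI) => I0 ID IM.
have [->|f0] := eqVneq f 0; first by exists 1%N; rewrite expr1.
pose F := {fraction mpoly n k}.
pose inF : {rmorphism mpoly n k -> F} := @tofrac _.
have F0 : inF f != 0 by rewrite tofrac_eq0.
(* [psi] puts 1 / f for X_0 and the old variables for the remaining ones, to which [wid] renames
   them. *)
pose psi : {rmorphism mpoly n.+1 k -> F} := mmap (inF \o @mpolyC n k)
  (fun i => oapp (fun j => inF (mpolyX k (mnm1 j))) (inF f)^-1 (unlift ord0 i)).
pose wid : {rmorphism mpoly n k -> mpoly n.+1 k} :=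
  mmap (@mpolyC n.+1 k) (fun j => mpolyX k (mnm1 (lift ord0 j))).
have psi_wid p : psi (wid p) = inF p.
  apply: (mpoly_rmorph_eq (f := psi \o wid) (g := inF)) => [c|i] /=.
    by rewrite /psi /wid /= !mmapC.
  by rewrite /psi /wid /= mmapX mmap1U mmapX mmap1U liftK.
have den u : exists m b, inF f ^+ m * psi u = inF b.
  elim/mpolyind: u => [|c m p _ _ [N [b pb]]].
    by exists 0%N, 0; rewrite !rmorph0 mulr0.
  have [M [a ma]] : exists M a, inF f ^+ M * psi (mpolyX k m) = inF a.
    rewrite mpolyXE_id rmorph_prod; apply: (big_ind (fun u : F =>
      exists M a, inF f ^+ M * u = inF a)) => [|x y|i _].
    - by exists 0%N, 1; rewrite mulr1 rmorph1.
    - move=> [M [a xa]] [M' [a' ya]]; exists (M + M')%N, (a * a').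
      by rewrite exprD mulrACA xa ya rmorphM.
    - rewrite rmorphXn /= /psi /= mmapX mmap1U.
      case: (unliftP ord0 i) => [j|] _ /=.
        exists 0%N, (mpolyX k (mnm1 j) ^+ m i).
        by rewrite mul1r rmorphXn.
      exists (m i), 1.
      by rewrite -exprMn mulfV // expr1n rmorph1.
  exists (M + N)%N, (f ^+ N * (mpolyC n c * a) + f ^+ M * b).
  rewrite -mul_mpolyC rmorphD rmorphM /= mulrDr !rmorphD !rmorphM /=.
  rewrite -ma -pb !rmorphXn exprD -!mulrA.
  have -> : psi (mpolyC n.+1 c) = inF (mpolyC n c) by rewrite /psi /= mmapC.
  by congr (_ + _); rewrite mulrCA; congr (_ * _); rewrite mulrCA.
(* [J] is the preimage under [psi] of the ideal generated by [I] once [f] is inverted; by [den], the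
   denominators are powers of [f]. *)
pose J u := exists m c, I c /\ inF f ^+ m * psi u = inF c.
have idJ : is_ideal J.
  split=> [|u u' [m [c [Ic uc]]] [m' [c' [Ic' uc']]]|u u' [m [c [Ic uc]]]].
  - by exists 0%N, 0; split=> //; rewrite !rmorph0 mulr0.
  - exists (m + m')%N, (f ^+ m' * c + f ^+ m * c'); split.
      by apply: ID; exact: IM.
    rewrite rmorphD mulrDr rmorphD !rmorphM /= -uc -uc'.
    by rewrite !rmorphXn exprD !mulrA [inF f ^+ m' * _]mulrC.
  - have [N [b ub]] := den u; exists (N + m)%N, (b * c).
    split; first exact: IM.
    by rewrite exprD !rmorphM mulrACA ub uc.
have JI c : I c -> J (wid c).
  by move=> Ic; exists 0%N, c; rewrite mul1r psi_wid.
have J1 : J (1 - mpolyX k (mnm1 ord0) * wid f).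
  exists 0%N, 0; split=> //; rewrite mul1r rmorphB rmorph1 rmorphM /= psi_wid.
  by rewrite /psi /= mmapX mmap1U unlift_none /= mulVf // subrr rmorph0.
(* If 1 lies in [J], a power of [f] lies in [I]. Otherwise a zero of [J] restricts to a zero of [I],
   where [f] vanishes, against 1 - X_0 f = 0. *)
have [[m [c [Ic]]]|nJ1] := pselect (J 1).
  rewrite rmorph1 mulr1 -rmorphXn => /eqP; rewrite tofrac_eq => /eqP fc.
  by exists m; rewrite fc.
have [v Jv] := weak_nullstellensatz idJ nJ1.
have wid_v p : meval v (wid p) = meval (v \o lift ord0) p.
  apply: (mpoly_rmorph_eq (f := meval v \o wid)
    (g := meval (v \o lift ord0))) => [c|i] /=.
    by rewrite /wid /= mmapC !mevalC.
  by rewrite /wid /= mmapX mmap1U !mevalXU.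
have := Jv _ J1; rewrite mevalB mevalM wid_v fI => [|p Ip]; last first.
  by rewrite -wid_v; apply/Jv/JI.
by rewrite mulr0 subr0 meval1 => /eqP; rewrite oner_eq0.
Qed.

End Nullstellensatz.

(** * Regular functions, morphisms and families of polynomials *)

Section SetType.
Variables (T : Type) (A : set T).

Lemma set_type_ex (x : T) : A x -> exists s : A, set_val s = x.
Proof. by move=> Ax; exists (exist _ x (mem_set Ax)). Qed.

Lemma set_val_in (s : A) : A (set_val s).
Proof. exact: (set_mem (valP s)). Qed.

Lemma set_val_inj : injective (set_val : A -> T).
Proof. by move=> s t; exact: val_inj. Qed.

End SetType.

Section RegularFunctions.
Variables (k : closedFieldType) (X : fspace k).
Implicit Types (U V : set X) (f g : X -> k).

Lemma regular_local U f : open U ->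
  (forall x, U x -> exists V g,
    [/\ open V, V x, regular V g & forall y, U y -> V y -> f y = g y]) ->
  regular U f.
Proof.
move=> oU H; apply: regular_glue => // x Ux.
have [V [g [oV Vx rg fg]]] := H x Ux.
exists (U `&` V), g; split=> //; first exact: openI.
  by apply: regular_sub rg; [exact: openI|exact: subIsetr].
by move=> y []; exact: fg.
Qed.

Lemma eq_regular U f g :
  open U -> regular U f -> (forall x, U x -> g x = f x) -> regular U g.
Proof.
move=> oU rf gf; apply: regular_local => // x Ux; exists U, f.
by split=> // y Uy _; exact: gf.
Qed.

Lemma regularN U f : open U -> regular U f -> regular U (fun x => - f x).
Proof.
move=> oU rf; apply: (eq_regular (f := fun x => -1 * f x)) => //.
  by apply: regularM => //; exact: regular_cst.
by move=> x _; rewrite mulN1r.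
Qed.

Lemma regularB U f g : open U -> regular U f -> regular U g ->
  regular U (fun x => f x - g x).
Proof. by move=> oU rf rg; apply: regularD => //; exact: regularN. Qed.

Lemma regular_sum U (I : Type) (r : seq I) (P : pred I) (F : I -> X -> k) :
  open U -> (forall i, P i -> regular U (F i)) ->
  regular U (fun x => \sum_(i <- r | P i) F i x).
Proof.
move=> oU rF; elim: r => [|i r IHr].
  by apply: eq_regular (regular_cst 0 oU) _ => // x _; rewrite big_nil.
have [Pi|Pi] := boolP (P i).
  apply: eq_regular (regularD oU (rF i Pi) IHr) _ => // x _.
  by rewrite big_cons Pi.
by apply: eq_regular IHr _ => // x _; rewrite big_cons (negbTE Pi).
Qed.

Lemma regular_prod U (I : Type) (r : seq I) (F : I -> X -> k) :
  open U -> (forall i, regular U (F i)) ->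
  regular U (fun x => \prod_(i <- r) F i x).
Proof.
move=> oU rF; elim: r => [|i r IHr].
  by apply: eq_regular (regular_cst 1 oU) _ => // x _; rewrite big_nil.
apply: eq_regular (regularM oU (rF i) IHr) _ => // x _.
by rewrite big_cons.
Qed.

Lemma regularX U f m : open U -> regular U f -> regular U (fun x => f x ^+ m).
Proof.
move=> oU rf; elim: m => [|m IHm]; first exact: regular_cst.
by apply: eq_regular (regularM oU rf IHm) _ => // x _; rewrite exprS.
Qed.

Lemma regular_meval U n (c : X -> 'rV[k]_n) (p : mpoly n k) : open U ->
  (forall i, regular U (fun x => c x 0 i)) ->
  regular U (fun x => meval (fun i => c x 0 i) p).
Proof.
move=> oU rc; apply: (eq_regular (f := fun x =>
  \sum_(m <- msupp p) mcoeff m p * \prod_i c x 0 i ^+ m i)) => //.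
apply: regular_sum => // m _; apply: regularM => //; first exact: regular_cst.
by apply: regular_prod => // i; exact: regularX.
Qed.

Lemma regular_det U n (M : X -> 'M[k]_n) : open U ->
  (forall i j, regular U (fun x => M x i j)) -> regular U (fun x => \det (M x)).
Proof.
move=> oU rM; apply: regular_sum => // s _.
apply: regularM => //; first exact: regular_cst.
exact: regular_prod.
Qed.

Lemma regular_mulmx U m n p (M : X -> 'M[k]_(m, n)) (N : X -> 'M[k]_(n, p)) :
  open U -> (forall i j, regular U (fun x => M x i j)) ->
  (forall i j, regular U (fun x => N x i j)) ->
  forall i j, regular U (fun x => (M x *m N x) i j).
Proof.
move=> oU rM rN i j.
apply: (eq_regular (f := fun x => \sum_l M x i l * N x l j)) => //; last first.
  by move=> x _; rewrite mxE.
by apply: regular_sum => // l _; exact: regularM.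
Qed.

Lemma regular_invmx U n (M : X -> 'M[k]_n) : open U ->
  (forall i j, regular U (fun x => M x i j)) ->
  (forall x, U x -> \det (M x) != 0) ->
  forall i j, regular U (fun x => invmx (M x) i j).
Proof.
move=> oU rM M0 i j.
apply: (eq_regular
  (f := fun x => (\det (M x))^-1 * cofactor (M x) j i)) => //; last first.
  by move=> x /M0 Mx; rewrite /invmx unitmxE unitfE Mx !mxE.
apply: regularM => //; first by apply: regularV => //; exact: regular_det.
rewrite /cofactor; apply: regularM => //; first exact: regular_cst.
apply: regular_det => // a b.
by apply: eq_regular (rM (lift j a) (lift i b)) _ => // x _; rewrite !mxE.
Qed.

End RegularFunctions.

Section MorphismTheory.
Variable k : closedFieldType.

Lemma morphism_local (Y Z : fspace k) (f : Y -> Z) :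
  (forall W g y, open W -> regular W g -> W (f y) ->
    exists V, [/\ open V, V y, V `<=` f @^-1` W & regular V (g \o f)]) ->
  morphism f.
Proof.
move=> H.
have open_pre W : open W -> open (f @^-1` W).
  move=> oW; rewrite openE => y Wy.
  (* Testing the hypothesis on the constant 0 gives continuity. *)
  have [V [oV Vy VW _]] := H W (fun=> 0) y oW (regular_cst 0 oW) Wy.
  by rewrite /interior nbhsE; exists V.
split; first by apply/continuousP => W; exact: open_pre.
move=> W g oW rg; apply: regular_local; first exact: open_pre.
move=> y Wy; have [V [oV Vy VW rgf]] := H W g y oW rg Wy.
by exists V, (g \o f).
Qed.

Lemma morphism_open (Y Z : fspace k) (f : Y -> Z) W :
  morphism f -> open W -> open (f @^-1` W).
Proof. by case=> /continuousP cf _; exact: cf. Qed.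

Lemma morphism_comp (X Y Z : fspace k) (f : X -> Y) (g : Y -> Z) :
  morphism f -> morphism g -> morphism (g \o f).
Proof.
move=> mf mg; split.
  apply/continuousP => W oW.
  by apply: (morphism_open (W := g @^-1` W) mf); exact: morphism_open.
move=> W h oW rh; apply: (mf.2 (g @^-1` W) (h \o g)).
  exact: morphism_open.
exact: mg.2.
Qed.

Lemma morphism_set_val (X : fspace k) (A : set X) :
  morphism (set_val : subsp A -> X).
Proof.
apply: morphism_local => W g y oW rg Wy.
exists (set_val @^-1` W); split=> //; first exact: open_setval.
by move=> w Ww; exists W, g.
Qed.

Lemma morphism_into_subsp (Y X : fspace k) (A : set X) (f : Y -> subsp A) :
  morphism (set_val \o f : Y -> X) -> morphism f.
Proof.
move=> mf; apply: morphism_local => _ g y [W oW <-] rg Wy.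
have [O [h [oO Oy rh gh]]] := rg (f y) Wy.
have oWO := openI oW oO.
exists ((set_val \o f) @^-1` (W `&` O)); split=> //.
- exact: (morphism_open mf).
- by move=> z [].
- apply: (eq_regular (f := h \o (set_val \o f))); first exact: morphism_open.
    apply: mf.2 => //.
    by apply: regular_sub rh => // z [].
  by move=> z [Wz Oz]; exact: gh.
Qed.

End MorphismTheory.

(** * Polynomials in the fibre coordinates with regular coefficients *)

Section PolyFamilies.
Variables (k : closedFieldType) (X : fspace k) (n : nat).
Implicit Types (U V : set X) (G H : X -> mpoly n k).

(** These are the elements of O(U)[y_1, ..., y_n], encoded by their specialisations at the points of
    [U]. *)
Definition poly_family U G :=
  exists (I : finType) (a : I -> X -> k) (p : I -> mpoly n k),
    (forall i, regular U (a i)) /\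
    forall x, U x -> G x = \sum_i a i x *: p i.

Definition fam_eval G (x : X) (y : 'rV[k]_n) := meval (fun i => y 0 i) (G x).

Lemma poly_family_sub U V G :
  open V -> V `<=` U -> poly_family U G -> poly_family V G.
Proof.
move=> oV VU [I [a [p [ra Ga]]]]; exists I, a, p; split=> [i|x /VU/Ga//].
exact: regular_sub (ra i).
Qed.

Lemma poly_familyZ U a (p : mpoly n k) :
  regular U a -> poly_family U (fun x => a x *: p).
Proof.
move=> ra; exists unit, (fun=> a), (fun=> p); split=> // x _.
by rewrite (big_pred1 tt) //; case.
Qed.

Lemma poly_family_cst U p : open U -> poly_family U (fun=> p).
Proof.
move=> oU; have [I [a [q [ra qE]]]] := poly_familyZ p (regular_cst 1 oU).
by exists I, a, q; split=> // x Ux; rewrite -qE // scale1r.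
Qed.

Lemma poly_familyD U V G H : open U -> open V ->
  poly_family U G -> poly_family V H ->
  poly_family (U `&` V) (fun x => G x + H x).
Proof.
move=> oU oV [I [a [p [ra Ga]]]] [J [b [q [rb Hb]]]].
have oUV := openI oU oV.
exists (I + J)%type, (fun t => match t with inl i => a i | inr j => b j end).
exists (fun t => match t with inl i => p i | inr j => q j end); split.
  case=> [i|j]; first by apply: regular_sub (ra i) => // x [].
  by apply: regular_sub (rb j) => // x [].
by move=> x [Ux Vx]; rewrite Ga // Hb // big_sumType.
Qed.

Lemma poly_familyM U V G H : open U -> open V ->
  poly_family U G -> poly_family V H ->
  poly_family (U `&` V) (fun x => G x * H x).
Proof.
move=> oU oV [I [a [p [ra Ga]]]] [J [b [q [rb Hb]]]].
have oUV := openI oU oV.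
exists (I * J)%type, (fun t x => a t.1 x * b t.2 x), (fun t => p t.1 * q t.2).
split=> [t|x [Ux Vx]].
  apply: regularM => //; first by apply: regular_sub (ra _) => // x [].
  by apply: regular_sub (rb _) => // x [].
rewrite Ga // Hb // big_distrlr /= pair_big /=.
by apply: eq_bigr => t _; rewrite -scalerAl -scalerAr scalerA.
Qed.

Lemma poly_family_mcoeff U G m :
  open U -> poly_family U G -> regular U (fun x => mcoeff m (G x)).
Proof.
move=> oU [I [a [p [ra Ga]]]].
apply: (eq_regular (f := fun x => \sum_i a i x * mcoeff m (p i))) => //.
  apply: regular_sum => // i _; apply: regularM => //; exact: regular_cst.
move=> x Ux; rewrite Ga // raddf_sum /=.
by apply: eq_bigr => i _; rewrite mcoeffZ.
Qed.

Lemma poly_family_regular (Y : fspace k) (pi : Y -> X) (c : Y -> 'rV[k]_n)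
    U (W : set Y) G :
  morphism pi -> open U -> open W -> W `<=` pi @^-1` U ->
  (forall j, regular W (fun e => c e 0 j)) -> poly_family U G ->
  regular W (fun e => fam_eval G (pi e) (c e)).
Proof.
move=> mpi oU oW WU rc [I [a [p [ra Ga]]]].
apply: (eq_regular (f := fun e => \sum_i a i (pi e) *
    meval (fun j => c e 0 j) (p i))) => //.
  apply: regular_sum => // i _; apply: regularM => //.
    by apply: regular_sub WU _ => //; apply: mpi.2.
  exact: regular_meval.
move=> e /WU Ue; rewrite /fam_eval Ga // raddf_sum /=.
by apply: eq_bigr => i _; rewrite mevalZ.
Qed.

End PolyFamilies.

(** * Regular functions on the product of U and k^n as quotients of families *)

Section Presentation.
Variables (k : closedFieldType) (X : fspace k) (U : set X) (n : nat).
Notation P := (prodsp (subsp U) (affine_space k n)).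
Implicit Types (p : P).

Definition pt_eval (G : X -> mpoly n k) (p : P) :=
  fam_eval G (set_val p.1) (p.2 : 'rV[k]_n).

(** The set [A] is a domain of validity that must contain the basic neighbourhood of [p0] where the
    quotient is defined; topology and regular functions are thus handled together. *)
Definition presented (p0 : P) (A : set P) (h : P -> k) :=
  exists (V : set X) G H, [/\ open V /\ V (set_val p0.1),
    poly_family V G, poly_family V H, pt_eval H p0 != 0 &
    forall p, V (set_val p.1) -> pt_eval H p != 0 ->
      A p /\ h p = pt_eval G p / pt_eval H p].

Let pt_evalD G H p :
  pt_eval (fun x => G x + H x) p = pt_eval G p + pt_eval H p.
Proof. exact: mevalD. Qed.

Let pt_evalM G H p :
  pt_eval (fun x => G x * H x) p = pt_eval G p * pt_eval H p.
Proof. exact: mevalM. Qed.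

Let pt_evalC q p : pt_eval (fun=> q) p = meval (fun i => (p.2 : 'rV[k]_n) 0 i) q.
Proof. by []. Qed.

Lemma presented_sub p0 A B h g : presented p0 A h ->
  (forall p, A p -> B p /\ g p = h p) -> presented p0 B g.
Proof.
move=> [V [G [H [oV fG fH H0 ABh]]]] AB; exists V, G, H; split=> // p Vp Hp.
by have [/AB[? ->] ->] := ABh p Vp Hp.
Qed.

Lemma presentedD p0 A B h g : presented p0 A h -> presented p0 B g ->
  presented p0 (A `&` B) (fun p => h p + g p).
Proof.
move=> [V [G [H [[oV Vp0] fG fH H0 AhE]]]] [W [K [L [[oW Wp0] fK fL L0 BgE]]]].
exists (V `&` W), (fun x => G x * L x + K x * H x), (fun x => H x * L x).
split.
- by split; [exact: openI|].
- rewrite -[V `&` W]setIid; apply: poly_familyD; try exact: openI.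
    exact: poly_familyM.
  by rewrite setIC; exact: poly_familyM.
- exact: poly_familyM.
- by rewrite pt_evalM mulf_neq0.
- move=> p [Vp Wp]; rewrite pt_evalD !pt_evalM mulf_eq0 negb_or => /andP[Hp Lp].
  have [Ap ->] := AhE p Vp Hp; have [Bp ->] := BgE p Wp Lp.
  by split=> //; rewrite addf_div.
Qed.

Lemma presentedM p0 A B h g : presented p0 A h -> presented p0 B g ->
  presented p0 (A `&` B) (fun p => h p * g p).
Proof.
move=> [V [G [H [[oV Vp0] fG fH H0 AhE]]]] [W [K [L [[oW Wp0] fK fL L0 BgE]]]].
exists (V `&` W), (fun x => G x * K x), (fun x => H x * L x).
split; [by split; [exact: openI|] | exact: poly_familyM | exact: poly_familyM |
  by rewrite pt_evalM mulf_neq0 |].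
move=> p [Vp Wp]; rewrite !pt_evalM mulf_eq0 negb_or => /andP[Hp Lp].
have [Ap ->] := AhE p Vp Hp; have [Bp ->] := BgE p Wp Lp.
by split=> //; rewrite mulf_div.
Qed.

Lemma presentedV p0 A h : presented p0 A h -> A p0 -> h p0 != 0 ->
  presented p0 (A `&` [set p | h p != 0]) (fun p => (h p)^-1).
Proof.
move=> [V [G [H [[oV Vp0] fG fH H0 AhE]]]] Ap0 hp0.
have G0 : pt_eval G p0 != 0.
  have [_] := AhE p0 Vp0 H0; move=> hE; move: hp0; rewrite hE.
  by rewrite mulf_eq0 negb_or => /andP[].
(* The quotient H / G is expanded by [H], so that a nonzero denominator still places the point where
   [AhE] applies. *)
exists (V `&` V), (fun x => H x * H x), (fun x => G x * H x).
split; [by split; [exact: openI|] | exact: poly_familyM | exact: poly_familyM |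
  by rewrite pt_evalM mulf_neq0 |].
move=> p [Vp _]; rewrite !pt_evalM mulf_eq0 negb_or => /andP[Gp Hp].
have [Ap hE] := AhE p Vp Hp.
split; first by split=> //=; rewrite hE mulf_neq0 // invr_eq0.
by rewrite hE invf_div -mulf_div divff // mulr1.
Qed.

Lemma presented_cst p0 a : presented p0 setT (fun=> a).
Proof.
exists setT, (fun=> mpolyC n a), (fun=> 1); rewrite !pt_evalC meval1.
split; [by split; [exact: openT|] | exact/poly_family_cst/openT |
  exact/poly_family_cst/openT | exact: oner_neq0 |].
by move=> p _ _; rewrite !pt_evalC mevalC meval1 divr1.
Qed.

Lemma presented_fst p0 (V : set (subsp U)) a : open V -> regular V a ->
  V p0.1 -> presented p0 [set p | V p.1] (fun p => a p.1).
Proof.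
move=> [O oO OV] ra Vp0; have [W [b [oW Wp0 rb ab]]] := ra _ Vp0.
have oOW := openI oO oW.
exists (O `&` W), (fun x => b x *: 1), (fun=> 1).
rewrite !pt_evalC meval1; split; last 4 first.
- by apply: poly_familyZ; apply: regular_sub rb => // x [].
- exact: poly_family_cst.
- exact: oner_neq0.
- move=> p [Op Wp] _; have Vp : V p.1 by rewrite -OV.
  by split=> //; rewrite ab // /pt_eval /fam_eval mevalZ meval1 mulr1 divr1.
- by split=> //; split=> //; move: Vp0; rewrite -OV.
Qed.

Lemma presented_snd p0 (V : set (affine_space k n)) b : open V ->
  regular V b -> V p0.2 -> presented p0 [set p | V p.2] (fun p => b p.2).
Proof.
rewrite quotient_openE => oV rb Vp0.
have [R [h [[RT [q hq]] _ h0 hV]]] := oV _ Vp0.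
have [S [a [c [[ST [r ar]] [_ [s cs]] _ c0 bac]]]] := rb _ Vp0.
have oT : open (setT : set X) by exact: openT.
(* Expanding by [q], whose nonvanishing locus lies in [V], confines the quotient r / s to [V]. *)
exists setT, (fun=> r * q), (fun=> s * q); rewrite !pt_evalC mevalM.
split; [by [] | exact: poly_family_cst | exact: poly_family_cst | |].
  by rewrite -hq -cs mulf_neq0.
move=> p _; rewrite !pt_evalC !mevalM -hq -cs -ar mulf_eq0 negb_or.
move=> /andP[cp hp]; have Vp : V p.2 by apply: hV; rewrite ?RT.
split=> //; rewrite bac ?ST //.
by rewrite -mulf_div divff // mulr1.
Qed.

Lemma presented_tensor p0 S h : tensor_num S h -> S p0 -> presented p0 S h.
Proof.
move=> [V [W [oV oW -> [I [a [b [ra rb hE]]]]]]] [Vp0 Wp0].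
have pVW : presented p0 (V `*` W) (fun=> 0).
  apply: (presented_sub (presentedD (presented_fst oV (regular_cst 0 oV) Vp0)
    (presented_snd oW (regular_cst 0 oW) Wp0))) => p [Vp Wp] /=.
  by rewrite addr0.
have psum r : presented p0 (V `*` W) (fun p => \sum_(i <- r) a i p.1 * b i p.2).
  elim: r => [|i r IHr].
    by apply: (presented_sub pVW) => p ?; rewrite big_nil.
  have pab := presentedM (presented_fst oV (ra i) Vp0)
    (presented_snd oW (rb i) Wp0).
  by apply: (presented_sub (presentedD pab IHr)) => p [_ ?]; rewrite big_cons.
by apply: (presented_sub (psum _)) => p Sp; rewrite hE.
Qed.

Lemma presented_regular p0 (W : set P) f :
  open W -> regular W f -> W p0 -> presented p0 W f.
Proof.
rewrite quotient_openE => oW rf Wp0.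
have [S [h [nh Sp0 hp0 hW]]] := oW _ Wp0.
have [R [a [b [na nb Rp0 bp0 fab]]]] := rf _ Wp0.
have pW := presentedV (presented_tensor nh Sp0) Sp0 hp0.
have pb := presentedV (presented_tensor nb Rp0) Rp0 bp0.
have pab := presentedM (presented_tensor na Rp0) pb.
(* Adding 0 times 1 / h changes no value but shrinks the domain into [W]. *)
apply: (presented_sub (presentedD pab (presentedM (presented_cst p0 0) pW))).
move=> p [[Rp [_ bp]] [_ [Sp hp]]]; have Wp := hW p Sp hp.
by rewrite mul0r addr0 fab.
Qed.

End Presentation.

(** * Products and charts *)

Section Products.
Variable k : closedFieldType.

Lemma prodsp_open_rect (X Y : fspace k) (U : set X) (V : set Y) :
  open U -> open V -> open (U `*` V : set (prodsp X Y)).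
Proof.
move=> oU oV; rewrite quotient_openE => p UVp.
exists (U `*` V), (fun=> 1); split=> //; last exact: oner_neq0.
exists U, V; split=> //; exists unit, (fun _ _ => 1), (fun _ _ => 1).
split=> [_|_|q _]; [exact: regular_cst|exact: regular_cst|].
by rewrite (big_pred1 tt) ?mulr1 //; case.
Qed.

Lemma morphism_snd (X Y : fspace k) : morphism (snd : prodsp X Y -> Y).
Proof.
have pre (W : set Y) : (snd : prodsp X Y -> Y) @^-1` W = setT `*` W.
  by apply/seteqP; split=> -[x y] //= [].
have oT : open (setT : set X) by exact: openT.
split; first by apply/continuousP => W oW; rewrite pre; exact: prodsp_open_rect.
move=> W g oW rg.
suff: quotient_regular (numP := tensor_numP X Y) (snd @^-1` W) (g \o snd) by [].
move=> p Wp.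
exists (setT `*` W), (g \o snd), (fun=> 1); split=> //.
- exists setT, W; split=> //; exists unit, (fun _ _ => 1), (fun _ => g).
  split=> [_|_|q _] //; first exact: regular_cst.
  by rewrite (big_pred1 tt) ?mul1r //; case.
- exists setT, W; split=> //; exists unit, (fun _ _ => 1), (fun _ _ => 1).
  split=> [_|_|q _] //; [exact: regular_cst|exact: regular_cst|].
  by rewrite (big_pred1 tt) ?mul1r //; case.
- exact: oner_neq0.
- by move=> q _ _ _; rewrite divr1.
Qed.

Lemma morphism_fst (X Y : fspace k) : morphism (fst : prodsp X Y -> X).
Proof.
have pre (W : set X) : (fst : prodsp X Y -> X) @^-1` W = W `*` setT.
  by apply/seteqP; split=> -[x y] //= [].
have oT : open (setT : set Y) by exact: openT.
split; first by apply/continuousP => W oW; rewrite pre; exact: prodsp_open_rect.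
move=> W g oW rg.
suff: quotient_regular (numP := tensor_numP X Y) (fst @^-1` W) (g \o fst) by [].
move=> p Wp.
exists (W `*` setT), (g \o fst), (fun=> 1); split=> //.
- exists W, setT; split=> //; exists unit, (fun _ => g), (fun _ _ => 1).
  split=> [_|_|q _] //; first exact: regular_cst.
  by rewrite (big_pred1 tt) ?mulr1 //; case.
- exists W, setT; split=> //; exists unit, (fun _ _ => 1), (fun _ _ => 1).
  split=> [_|_|q _] //; [exact: regular_cst|exact: regular_cst|].
  by rewrite (big_pred1 tt) ?mul1r //; case.
- exact: oner_neq0.
- by move=> q _ _ _; rewrite divr1.
Qed.

Lemma affine_coord_regular n j :
  regular (setT : set (affine_space k n)) (fun y => (y : 'rV[k]_n) 0 j).
Proof.
move=> y _; exists setT, (fun v : 'rV_n => v 0 j), (fun=> 1); split=> //.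
- by split=> //; exists (mpolyX k (mnm1 j)) => v; rewrite mevalXU.
- by split=> //; exists 1 => v; rewrite meval1.
- exact: oner_neq0.
- by move=> q _ _ _; rewrite divr1.
Qed.

Lemma prodsp_coord_regular (X : fspace k) n j :
  regular (setT : set (prodsp X (affine_space k n)))
    (fun p => (p.2 : 'rV[k]_n) 0 j).
Proof.
exact: ((morphism_snd X _).2 setT _ openT (@affine_coord_regular n j)).
Qed.

(** The complement of the diagonal contains a basic neighbourhood of (y, x); its slice at [x] is a
    neighbourhood of [y] that avoids [x]. *)
Lemma separated_closed1 (X : fspace k) (x : X) :
  Defs.separated X -> closed [set x].
Proof.
move=> /closed_openC; rewrite quotient_openE => sepX.
rewrite -(setCK [set x]); apply: open_closedC; rewrite openE => y yx.
have [S [h [nh Sp hp hD]]] := sepX (y, x) yx.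
case: nh => U [V [oU oV SE [I [a [b [ra rb hE]]]]]].
rewrite SE in Sp hE hD; case: Sp => /= Uy Vx.
have rg : regular U (fun z => \sum_i a i z * b i x).
  by apply: regular_sum => // i _; apply: regularM => //; exact: regular_cst.
rewrite /interior nbhsE; exists [set z | U z /\ \sum_i a i z * b i x != 0].
  split; first exact: (regular_open oU rg).
  by split=> //; rewrite -(hE (y, x)).
move=> z [Uz hz] zx; rewrite /= in zx; rewrite zx in Uz hz.
by apply: (hD (x, x)) => //; rewrite hE.
Qed.

End Products.

(** * Fibre coordinates and the ideal of a fibre *)

Section Charts.
Variable k : closedFieldType.

(** A trivialization over [U] in terms of total functions: [c] gives the fibre coordinates, and
    [chart_presented] stands for the isomorphism with the product by describing open sets and
    regular functions through families. *)
Record chart (X Y : fspace k) (pi : Y -> X) (U : set X) n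
    (c : Y -> 'rV[k]_n) : Prop := Chart {
  chart_open : open U;
  chart_morphism : morphism pi;
  chart_surj : forall x y, U x -> exists2 e, pi e = x & c e = y;
  chart_inj : forall e e', U (pi e) -> pi e = pi e' -> c e = c e' -> e = e';
  chart_coord : forall j, regular (pi @^-1` U) (fun e => c e 0 j);
  chart_presented : forall W f e0,
    open W -> regular W f -> W e0 -> U (pi e0) ->
    exists (V : set X) G H, [/\ [/\ open V, V (pi e0) & V `<=` U],
      poly_family V G, poly_family V H, fam_eval H (pi e0) (c e0) != 0 &
      forall e, V (pi e) -> fam_eval H (pi e) (c e) != 0 ->
        W e /\ f e = fam_eval G (pi e) (c e) / fam_eval H (pi e) (c e)]
}.

(** [Y] carries the structure induced from [Z]. This lets [trivialization_chart] serve both for the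
    bundle, with [i] the identity, and for a closed subvariety, with [i] the inclusion. *)
Definition embedding (Y Z : fspace k) (i : Y -> Z) :=
  [/\ injective i, forall O, open O -> open (i @^-1` O),
      forall W, open W -> exists2 O, open O & W = i @^-1` O &
      forall W f, open W -> regular W f <-> (forall w, W w -> exists O g,
        [/\ open O, O (i w), regular O g &
            forall v, W v -> O (i v) -> f v = g (i v)])].

Lemma embedding_id (Y : fspace k) : embedding (id : Y -> Y).
Proof.
split=> // [W oW|W f oW]; first by exists W.
split=> [rf w Ww|H]; first by exists W, f.
exact: regular_local.
Qed.

Lemma embedding_set_val (X : fspace k) (A : set X) :
  embedding (set_val : subsp A -> X).
Proof.
split=> //; first exact: open_setval.
by move=> _ [O oO <-]; exists O.
Qed.

Lemma trivialization_chart (X : fspace k) (E : vfamily X) (Y : fspace k)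
    (i : Y -> E) (S : set E) (U : set X) d
    (f : subsp S -> prodsp (subsp U) (affine_space k d)) :
  open U -> morphism (vproj E) -> embedding i ->
  (forall e, S e <-> (exists y, i y = e) /\ U (vproj E e)) ->
  trivialization f ->
  exists2 c : Y -> 'rV[k]_d, chart (vproj E \o i) U c &
    forall x a (u v : vfibre E x) (p q r : Y), U x ->
      i p = fibre_pt u -> i q = fibre_pt v -> i r = fibre_pt (a *: u + v) ->
      c r = a *: c p + c q.
Proof.
move=> oU mpi embi SE [[mf [g [mg fK gK]]] fpi flin].
have [inj_i pre_i open_i reg_i] := embi.
have mi : morphism i.
  split; first by apply/continuousP; exact: pre_i.
  move=> V h oV rh; apply/reg_i => [|w Vw]; first exact: pre_i.
  by exists V, h.
have mpii := morphism_comp mi mpi.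
have toS y : U (vproj E (i y)) -> exists s : S, set_val s = i y.
  by move=> Uy; apply/set_type_ex/SE; split=> //; exists y.
(* The value 0 is a placeholder off [S]; by [toS] every point over [U] lies in [S]. *)
pose c y : 'rV[k]_d := match pselect (S (i y)) with
  | left h => (f (exist _ (i y) (mem_set h))).2 | right _ => 0 end.
have cE y (s : S) : set_val s = i y -> c y = (f s).2.
  move=> sy; rewrite /c; case: pselect => [h|[]]; last first.
    by rewrite -sy; exact: set_val_in.
  by congr (f _).2; apply: set_val_inj; rewrite sy.
exists c; last first.
  move=> x a u v p q r Ux pu qv rE.
  have fib (w : vfibre E x) : vproj E (fibre_pt w) = x.
    exact: (@set_val_in _ (vproj E @^-1` [set x]) w).
  have [sp spE] : exists s : S, set_val s = i p.
    by apply: toS; rewrite pu fib.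
  have [sq sqE] : exists s : S, set_val s = i q.
    by apply: toS; rewrite qv fib.
  have [sr srE] : exists s : S, set_val s = i r.
    by apply: toS; rewrite rE fib.
  rewrite (cE _ _ spE) (cE _ _ sqE) (cE _ _ srE).
  by apply: (flin x a u v sp sq sr); rewrite ?spE ?sqE ?srE.
have fpt e (s : S) : set_val s = i e -> set_val (f s).1 = vproj E (i e).
  by move=> se; rewrite fpi se.
split=> //.
- move=> x y Ux; have [xs xsE] := set_type_ex Ux.
  pose s := g (xs, y); have := set_val_in s.
  move=> /SE[[e ie] _]; exists e => /=; last first.
    by rewrite (cE e s) // /s gK.
  by rewrite -(fpt e s) // /s gK.
- move=> e e' /= Ue ee' cc'.
  have [s sE] := toS e Ue; rewrite ee' in Ue; have [s' s'E] := toS e' Ue.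
  have fss' : f s = f s'.
    rewrite [f s]surjective_pairing [f s']surjective_pairing.
    rewrite -(cE _ _ sE) -(cE _ _ s'E) cc'; congr (_, _).
    by apply: set_val_inj; rewrite (fpt _ _ sE) (fpt _ _ s'E).
  by apply: inj_i; rewrite -sE -s'E (can_inj fK fss').
- move=> j; have oV := morphism_open mpii oU.
  apply/reg_i => // w Uw; have [s sE] := toS w Uw.
  have [O [h [oO Os rh fh]]] :=
    mf.2 setT _ openT (@prodsp_coord_regular _ (subsp U) d j) s I.
  exists O, h; split=> //; first by rewrite -sE.
  move=> v Uv Ov; have [t tE] := toS v Uv.
  by rewrite (cE _ _ tE) -tE; apply: fh => //; rewrite tE.
- move=> W h e0 oW rh We0 Ue0.
  have [O1 oO1 WO1] := open_i W oW.
  have [O2 [h2 [oO2 O2e0 rh2 hh2]]] := (reg_i W h oW).1 rh e0 We0.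
  have oO := openI oO1 oO2.
  pose T : set (subsp S) := set_val @^-1` (O1 `&` O2).
  have oT : open T by exact: open_setval.
  have rT : regular T (h2 \o set_val).
    apply: (@morphism_set_val _ _ S).2 => //.
    by apply: regular_sub rh2 => // z [].
  have [s0 s0E] := toS e0 Ue0.
  have T0 : (g @^-1` T) (f s0).
    by rewrite /T /= fK s0E; split=> //; rewrite WO1 in We0.
  have [V [G [H [[oV Vp0] fG fH H0 TE]]]] :=
    presented_regular (morphism_open mg oT) (mg.2 T _ oT rT) T0.
  have oVU := openI oV oU.
  have evE K e (s : S) : set_val s = i e ->
      pt_eval K (f s) = fam_eval K (vproj E (i e)) (c e).
    by move=> se; rewrite /pt_eval (fpt _ _ se) (cE _ _ se).
  have Ve0 : V (vproj E (i e0)) by rewrite -(fpt e0 s0).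
  exists (V `&` U), G, H; split.
  + by split=> // x [].
  + by apply: poly_family_sub fG => // x [].
  + by apply: poly_family_sub fH => // x [].
  + by rewrite /= -(evE _ _ s0).
  + move=> e [Ve Ue]; have [s sE] := toS e Ue.
    rewrite /= -!(evE _ _ s) // => He.
    have [] := TE (f s); rewrite ?(fpt e s) // /T /= fK sE => -[O1e O2e] <-.
    have We : W e by rewrite WO1.
    by split=> //; rewrite hh2.
Qed.

(* Writing f as a quotient of families near the fibre, one may replace every
   coefficient a of the numerator by a - a x, the difference being zero there. *)
Lemma chart_vanish (X Y : fspace k) (pi : Y -> X) (U : set X) n
    (c : Y -> 'rV[k]_n) (x : X) (W : set Y) (f : Y -> k) :
  chart pi U c -> U x -> closed [set x] -> open W -> regular W f ->
  (forall e, W e -> pi e = x -> f e = 0) -> scheme_fibre pi x W f.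
Proof.
move=> ch Ux clx oW rf fx; split=> // y Wy.
have mpi := chart_morphism ch.
have [yx|yx] := pselect (pi y = x); last first.
  (* Off [x] the ideal of [x] is the unit ideal, so [f] is [f] times the section 1. *)
  have oNx : open (~` [set x]) by exact: closed_openC.
  have oV := openI oW (morphism_open mpi oNx).
  exists (W `&` pi @^-1` (~` [set x])), (~` [set x]); split=> //.
  exists 1%N, (fun=> f), (fun _ _ => 1); split=> [_|_|z _].
  - by apply: regular_sub rf => // z [].
  - by split=> //; exact: regular_cst.
  - by rewrite big_ord1 mulr1.
have Uy : U (pi y) by rewrite yx.
have [V [G [H [[oV Vy VU] [I [a [p [ra Ga]]]] fH H0 fE]]]] :=
  chart_presented ch oW rf Wy Uy.
have Vx : V x by rewrite -yx.
pose W0 := W `&` pi @^-1` V.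
have oW0 : open W0 by apply: openI => //; exact: morphism_open.
have W0V : W0 `<=` pi @^-1` V by move=> z [].
have rc j : regular W0 (fun e => c e 0 j).
  by apply: regular_sub (chart_coord ch j) => // z /W0V/VU.
pose r1 e := fam_eval H (pi e) (c e).
(* [r2] is the denominator with its coefficients frozen at [x]. Where it is nonzero, the point over
   [x] with the same coordinates as [e] lies in the domain of the quotient, so that the numerator at
   [x] vanishes in these coordinates. *)
pose r2 e := meval (fun j => c e 0 j) (H x).
have rr1 : regular W0 r1 by exact: (poly_family_regular mpi oV).
have rr2 : regular W0 r2 by exact: regular_meval.
pose N := [set e | W0 e /\ r1 e * r2 e != 0].
have oN : open N by apply: (regular_open oW0); exact: regularM.
have NW0 : N `<=` W0 by move=> z [].
exists N, V; split=> //.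
- split; first by split.
  by rewrite /r1 /r2 -yx mulf_neq0.
- by move=> z [[]].
- by split=> // z [[]].
pose q i e := meval (fun j => c e 0 j) (p i).
exists #|I|, (fun t e => q (enum_val t) e / r1 e).
exists (fun t z => a (enum_val t) z - a (enum_val t) x); split=> [t|t|e].
- apply: regularM => //.
    by apply: regular_sub NW0 _ => //; exact: regular_meval.
  apply: regularV => //; first exact: regular_sub NW0 rr1.
  by move=> z [_]; rewrite mulf_eq0 negb_or => /andP[].
- split; first by apply: regularB => //; exact: regular_cst.
  by move=> z _ ->; rewrite subrr.
move=> [[We Ve]]; rewrite mulf_eq0 negb_or => /andP[r1e r2e].
have [e' e'x ce'] := chart_surj ch (c e) Ux.
have Gx : fam_eval G x (c e) = 0.
  have := fE e'; rewrite e'x ce' => /(_ Vx r2e)[We' fe'].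
  have := fx e' We' e'x; rewrite fe' => /eqP; rewrite mulf_eq0 invr_eq0.
  by move=> /orP[/eqP//|/negPn]; rewrite r2e.
have GE z : V z -> fam_eval G z (c e) = \sum_i a i z * q i e.
  move=> Vz; rewrite /fam_eval Ga // raddf_sum /=.
  by apply: eq_bigr => i _; rewrite mevalZ.
have [_ ->] := fE e Ve r1e.
have -> : fam_eval G (pi e) (c e) = \sum_i (a i (pi e) - a i x) * q i e.
  under eq_bigr do rewrite mulrBl.
  by rewrite sumrB -!GE // Gx subr0.
rewrite mulr_suml.
rewrite [RHS](reindex_onto enum_rank enum_val) /=; last first.
  by move=> t _; rewrite enum_valK.
rewrite [RHS](eq_bigl xpredT); last by move=> t /=; rewrite enum_rankK eqxx.
by apply: eq_bigr => i _; rewrite enum_rankK -mulrA mulrC.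
Qed.

End Charts.

(** * Reducedness of fibres and intersections *)

Section ReducedFibres.
Variable k : closedFieldType.

Lemma finite_open_inter (X : topologicalType) (I : finType) (O : I -> set X) x :
  (forall i, open (O i)) -> (forall i, O i x) ->
  exists V, [/\ open V, V x & forall i, V `<=` O i].
Proof.
move=> oO Ox.
suff [V [oV Vx VO]] : exists V, [/\ open V, V x &
    forall i, i \in enum I -> V `<=` O i].
  by exists V; split=> // i; apply: VO; rewrite mem_enum.
elim: (enum I) => [|i r [V [oV Vx VO]]].
  by exists setT; split=> //; exact: openT.
exists (O i `&` V); split=> //; first exact: openI.
move=> j; rewrite in_cons => /orP[/eqP-> z []//|/VO Vj z [_]].
exact: Vj.
Qed.

Lemma sub_regular_extend (X : fspace k) (A : set X) (V : set (subsp A)) m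
    (a : 'I_m -> subsp A -> k) e :
  (forall i, regular V (a i)) -> V e ->
  exists O (b : 'I_m -> X -> k), [/\ open O, O (set_val e),
    forall i, regular O (b i) &
    forall i v, V v -> O (set_val v) -> a i v = b i (set_val v)].
Proof.
move=> ra Ve.
have /choice[Ob H] : forall i, exists Ob : set X * (X -> k), [/\ open Ob.1,
    Ob.1 (set_val e), regular Ob.1 Ob.2 &
    forall v, V v -> Ob.1 (set_val v) -> a i v = Ob.2 (set_val v)].
  by move=> i; have [O [b H]] := ra i e Ve; exists (O, b).
have [O [oO Oe Osub]] := @finite_open_inter X 'I_m (fun i => (Ob i).1)
  (set_val e) (fun i => let: And4 h _ _ _ := H i in h)
  (fun i => let: And4 _ h _ _ := H i in h).
exists O, (fun i => (Ob i).2); split=> // i.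
  by have [_ _ rb _] := H i; exact: regular_sub (Osub i) rb.
by move=> v Vv Ov; have [_ _ _] := H i; apply => //; exact: Osub.
Qed.

Section Pullback.
Variables (X Y : fspace k) (f : Y -> X) (J : ideal_sheaf X).

Lemma ideal_pullback_sub (V W : set Y) s t : open V -> V `<=` W ->
  (forall z, V z -> t z = s z) ->
  ideal_pullback f J W s -> ideal_pullback f J V t.
Proof.
move=> oV VW ts [rs Hs]; split.
  exact: eq_regular (regular_sub oV VW rs) ts.
move=> y Vy; have [N [U [oN Ny NW [oU NU] [m [a [g [ra Jg sE]]]]]]] := Hs y (VW _ Vy).
have oVN := openI oV oN.
exists (V `&` N), U; split=> //; first by split=> // z [_ /NU].
exists m, a, g; split=> // [i|z [Vz Nz]]; last by rewrite ts // sE.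
by apply: regular_sub (ra i) => // z [].
Qed.

Lemma ideal_pullback_glue (W : set Y) s : regular W s ->
  (forall w, W w -> exists V, [/\ open V, V w, V `<=` W &
    ideal_pullback f J V s]) -> ideal_pullback f J W s.
Proof.
move=> rs H; split=> // w /H[V [oV Vw VW [_ /(_ w Vw)]]].
move=> [N [U [oN Nw NV NU ex]]]; exists N, U; split=> //.
exact: subset_trans VW.
Qed.

End Pullback.

Lemma scheme_fibre_zero (X Y : fspace k) (f : Y -> X) x W s y :
  scheme_fibre f x W s -> W y -> f y = x -> s y = 0.
Proof.
move=> [_ H] Wy fyx; have [V [U [_ Vy _ [_ VU] [m [a [g [_ gx ->//]]]]]]] := H y Wy.
apply: big1 => i _; have [_ ->] := gx i; rewrite ?mulr0 //.
exact: VU.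
Qed.

(** * Comparing the scheme-theoretic intersection with the scheme-theoretic fibre *)

Section Intersection.
Variables (X : fspace k) (E : vfamily X) (F : set E) (x : X).
Hypothesis mpi : morphism (vproj E).
Hypothesis closedF : closed F.
Hypothesis fibre_vanish : forall (V : set E) b, open V -> regular V b ->
  (forall e, V e -> vproj E e = x -> b e = 0) -> scheme_fibre (vproj E) x V b.

(** By [fibre_vanish] the functions vanishing on E_x are generated by those vanishing at [x], and
    the functions vanishing on [F] restrict to 0. Conversely, a combination on [F] has coefficients
    that extend locally to [E], and [f] minus the extended combination vanishes on [F]. *)
Lemma scheme_interE (W : set E) f : open W -> regular W f ->
  scheme_inter F (vproj E @^-1` [set x]) W f <->
  scheme_fibre (restr_proj F) x (set_val @^-1` W) (f \o set_val).
Proof.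
move=> oW rf; split=> [[_ HW]|[_ HW]]; split.
- exact: (@morphism_set_val _ _ F).2.
- move=> w Ww; have [V [a [b [oV Vw VW [[ra aF] [rb bx]] fab]]]] := HW _ Ww.
  have [_ /(_ _ Vw)] := fibre_vanish oV rb bx.
  move=> [N [U [oN Nw NV [oU NU] [m [q [g [rq gx bE]]]]]]].
  exists (set_val @^-1` N), U; split=> //.
  + exact: open_setval.
  + by move=> z /NV/VW.
  + by split=> // z /NU.
  exists m, (fun i => q i \o set_val), g; split=> //.
    by move=> i; exact: (@morphism_set_val _ _ F).2.
  move=> z Nz /=; rewrite fab; last exact: NV.
  rewrite aF ?add0r ?bE //; first exact: NV.
  exact: set_val_in.
- by [].
- move=> e We; have [Fe|nFe] := pselect (F e); last first.
    (* Off [F] every function belongs to the ideal of [F]. *)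
    have oV := openI oW (closed_openC closedF).
    exists (W `&` ~` F), f, (fun=> 0); split=> //.
    + split; split=> //; last exact: regular_cst.
        by apply: regular_sub rf => // z [].
      by move=> z [].
    + by move=> z _; rewrite addr0.
  have [w we] := set_type_ex Fe.
  have Ww : (set_val @^-1` W) w by rewrite /= we.
  have [_ [U [[V oV <-] Vw VW [oU VU] [m [q [g [rq gx fE]]]]]]] := HW w Ww.
  have [O [b [oO Ow rb qb]]] := sub_regular_extend rq Vw.
  have oN := openI (openI oW oV) (openI oO (morphism_open mpi oU)).
  set N := _ `&` _ in oN.
  have rB : regular N (fun z => \sum_i b i z * g i (vproj E z)).
    apply: regular_sum => // i _; apply: regularM => //.
      by apply: regular_sub (rb i) => // z [_ []].
    have [rg _] := gx i.
    by apply: regular_sub (mpi.2 _ _ oU rg) => // z [_ []].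
  have rfN : regular N f by apply: regular_sub rf => // z [[]].
  exists N, (fun z => f z - \sum_i b i z * g i (vproj E z)).
  exists (fun z => \sum_i b i z * g i (vproj E z)); split=> //.
  + rewrite -we; split; first by [].
    by split=> //; exact: VU.
  + by move=> z [[]].
  + split; split=> //; first exact: regularB.
      move=> z [[Wz Vz] [Oz Uz]] Fz; have [v vz] := set_type_ex Fz.
      have := fE v; rewrite /= vz => ->//; apply/eqP; rewrite subr_eq0; apply/eqP.
      by apply: eq_bigr => i _; rewrite qb /= ?vz // /restr_proj vz.
    move=> z [_ [_ Uz]] zx; apply: big1 => i _.
    by have [_ ->] := gx i; rewrite ?mulr0.
  + by move=> z _; rewrite subrK.
Qed.

(** Regular functions on [F] lift locally to [E], so [scheme_interE] transports the condition,
    membership in the ideal of the fibre being local. *)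
Lemma reduced_inter_fibre :
  reduced_subscheme (scheme_inter F (vproj E @^-1` [set x])) <->
  reduced_subscheme (scheme_fibre (restr_proj F) x).
Proof.
split=> red W f m oW rf Jf; last first.
  apply/scheme_interE => //; apply: (red _ _ m); first exact: open_setval.
    exact: (@morphism_set_val _ _ F).2.
  by have /scheme_interE := Jf; apply=> //; exact: regularX.
apply: ideal_pullback_glue => // w Ww.
have [O oO OW] := oW; have [O' [g [oO' O'w rg fg]]] := rf w Ww.
have oN := openI oO oO'; have rgN : regular (O `&` O') g.
  by apply: regular_sub rg => // z [].
have NW (z : subsp F) : (O `&` O') (set_val z) -> W z by rewrite -OW => -[].
have oN' : open (set_val @^-1` (O `&` O') : set (subsp F)) by exact: open_setval.
exists (set_val @^-1` (O `&` O')); split=> //.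
  by split=> //; move: Ww; rewrite -OW.
suff : scheme_fibre (restr_proj F) x (set_val @^-1` (O `&` O')) (g \o set_val).
  apply: ideal_pullback_sub => // z Nz; rewrite fg //; first exact: NW.
  by case: Nz.
apply/scheme_interE => //; apply: (red _ _ m) => //.
apply/scheme_interE => //; first exact: regularX.
apply: ideal_pullback_sub Jf => // z Nz /=; rewrite fg //; first exact: NW.
by case: Nz.
Qed.

End Intersection.

(** If a power of [f] lies in the ideal of the fibre, [f] vanishes at its points, and [chart_vanish]
    applies. *)
Lemma chart_fibre_reduced (X Y : fspace k) (pi : Y -> X) (U : set X) n
    (c : Y -> 'rV[k]_n) (x : X) :
  chart pi U c -> U x -> closed [set x] ->
  reduced_subscheme (scheme_fibre pi x).
Proof.
move=> ch Ux clx W f m oW rf Jf; apply: (chart_vanish ch) => // e We ex.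
have /eqP := scheme_fibre_zero Jf We ex.
by rewrite expf_eq0 => /andP[_ /eqP].
Qed.

(** The universal property of the product: pulling back a quotient of families involves only the
    base component and the fibre coordinates. [chart_lift] is the analogue for a chart. *)
Lemma morphism_into_prod (X Y : fspace k) (U : set X) n
    (f : Y -> prodsp (subsp U) (affine_space k n)) :
  morphism ((fun y => set_val (f y).1) : Y -> X) ->
  (forall j, regular setT (fun y => ((f y).2 : 'rV[k]_n) 0 j)) -> morphism f.
Proof.
move=> mf1 rf2; apply: morphism_local => W g y oW rg Wy.
have [V [G [H [[oV Vy] fG fH H0 WE]]]] := presented_regular oW rg Wy.
pose V' := (fun y => set_val (f y).1) @^-1` V.
have oV' : open V' := morphism_open mf1 oV.
have rc j : regular V' (fun y => ((f y).2 : 'rV[k]_n) 0 j).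
  exact: regular_sub (rf2 j).
have rG := poly_family_regular mf1 oV oV' (@subset_refl _ _) rc fG.
have rH := poly_family_regular mf1 oV oV' (@subset_refl _ _) rc fH.
have oN := regular_open oV' rH; set N := [set _ | _] in oN.
exists N; split=> //; first by move=> z [Vz Hz]; have [] := WE (f z) Vz Hz.
apply: (eq_regular (f := fun z => pt_eval G (f z) / pt_eval H (f z))) => //.
  apply: regularM => //; first by apply: regular_sub rG => // z [].
  apply: regularV => //; first by apply: regular_sub rH => // z [].
  by move=> z [].
by move=> z [Vz Hz]; have [_] := WE (f z) Vz Hz.
Qed.

Lemma chart_lift (X Y Z : fspace k) (pi : Y -> X) (U : set X) n
    (c : Y -> 'rV[k]_n) (g : Z -> Y) :
  chart pi U c -> (forall z, U (pi (g z))) -> morphism (pi \o g) ->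
  (forall j, regular setT (fun z => c (g z) 0 j)) -> morphism g.
Proof.
move=> ch Ug mg rc; apply: morphism_local => W h z oW rh Wz.
have [V [G [H [[oV Vz VU] fG fH H0 WE]]]] := chart_presented ch oW rh Wz (Ug z).
have oV' := morphism_open mg oV.
have rc' j : regular ((pi \o g) @^-1` V) (fun z => c (g z) 0 j).
  exact: regular_sub (rc j).
have rG := poly_family_regular mg oV oV' (@subset_refl _ _) rc' fG.
have rH := poly_family_regular mg oV oV' (@subset_refl _ _) rc' fH.
have oN := regular_open oV' rH; set N := [set _ | _] in oN.
exists N; split=> //; first by move=> t [Vt Ht]; have [] := WE (g t) Vt Ht.
apply: (eq_regular (f := fun t => fam_eval G ((pi \o g) t) (c (g t)) /
    fam_eval H ((pi \o g) t) (c (g t)))) => //.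
  apply: regularM => //; first by apply: regular_sub rG => // t [].
  apply: regularV => //; first by apply: regular_sub rH => // t [].
  by move=> t [].
by move=> t [Vt Ht]; have [_] := WE (g t) Vt Ht.
Qed.

End ReducedFibres.

(** * Local triviality *)

Section LinearPart.
Variables (k : closedFieldType) (n : nat).
Implicit Types (p q : mpoly n k) (y : 'rV[k]_n).

Definition line_restr y p : {poly k} := mmap polyC (fun i => y 0 i *: 'X) p.

Lemma line_restr_horner y p t :
  (line_restr y p).[t] = meval (fun i => (t *: y) 0 i) p.
Proof.
apply: (mpoly_rmorph_eq (f := horner_eval t \o mmap polyC (fun i => y 0 i *: 'X))
  (g := meval (fun i => (t *: y) 0 i))) => [c|i] /=; rewrite /horner_eval.
  by rewrite mmapC mevalC hornerC.
by rewrite mmapX mmap1U mevalXU hornerZ hornerX mxE mulrC.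
Qed.

Lemma line_restr_coef1 y p :
  (line_restr y p)`_1 = \sum_i y 0 i * mcoeff (mnm1 i) p.
Proof.
elim/mpolyind: p => [|c m p _ _ IHp].
  rewrite /line_restr rmorph0 coef0 big1 // => i _.
  by rewrite mcoeff0 mulr0.
rewrite /line_restr mmapD coefD -/(line_restr y p) IHp.
under [RHS]eq_bigr do rewrite mcoeffD mulrDr.
rewrite big_split; congr (_ + _); rewrite mmapZ mmapX coefCM.
under eq_bigr do rewrite mcoeffZ mcoeffX mulrCA.
rewrite -mulr_sumr; congr (_ * _).
have [/mdeg1P[i /eqP->]|m1] := boolP (mdeg m == 1%N).
  rewrite mmap1U coefZ coefX eqxx mulr1 (bigD1 i) //= eqxx mulr1.
  rewrite big1 ?addr0 // => j ji; case: eqP => [ij|]; last by rewrite mulr0.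
  have /(congr1 (fun m : multinom n => m j)) := ij.
  by rewrite /= !mnm1E eqxx eq_sym (negbTE ji).
rewrite big1 => [|i _]; last first.
  case: eqP => [mi|]; last by rewrite mulr0.
  by rewrite mi mdeg1 in m1.
suff -> : mmap1 (fun i => y 0 i *: 'X) m =
    (\prod_i y 0 i ^+ m i) *: 'X^(mdeg m) :> {poly k}.
  by rewrite coefZ coefXn eq_sym (negbTE m1) mulr0.
rewrite /mmap1 mdegE; under [LHS]eq_bigr do rewrite exprZn.
by rewrite scaler_prod prodrXr.
Qed.

Lemma poly_eq_horner (p q : {poly k}) : (forall t, p.[t] = q.[t]) -> p = q.
Proof.
move=> pq; apply/eqP; rewrite -subr_eq0; apply: contrapT => /negP.
move=> /closed_nonrootP[t]; rewrite rootE hornerD hornerN pq subrr.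
by rewrite eqxx.
Qed.

(** The restriction of [p] to the line spanned by [y] vanishes everywhere on the infinite field [k],
    so its coefficient of degree one is zero. *)
Lemma vanish_linear_part y p :
  (forall t, meval (fun i => (t *: y) 0 i) p = 0) ->
  \sum_i y 0 i * mcoeff (mnm1 i) p = 0.
Proof.
move=> py; rewrite -line_restr_coef1 (_ : line_restr y p = 0) ?coef0 //.
by apply: poly_eq_horner => t; rewrite line_restr_horner horner0.
Qed.

Definition linear_poly (l : 'cV[k]_n) : mpoly n k :=
  \sum_i l i 0 *: mpolyX k (mnm1 i).

Lemma meval_linear_poly l y :
  meval (fun i => y 0 i) (linear_poly l) = (y *m l) 0 0.
Proof.
rewrite raddf_sum mxE; apply: eq_bigr => i _.
by rewrite /= mevalZ mevalXU mulrC.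
Qed.

(** A linear form has no constant term, so only the constant term of [q] contributes in degree one;
    the comparison is made along the coordinate axes. *)
Lemma mcoeff1_mul_linear p q (l : 'cV[k]_n) :
  (forall y : 'rV_n, meval (fun i => y 0 i) p =
    meval (fun i => y 0 i) q * (y *m l) 0 0) ->
  forall i, mcoeff (mnm1 i) p = meval (fun=> 0) q * l i 0.
Proof.
move=> pql i; pose y : 'rV[k]_n := delta_mx 0 i.
have <- : \sum_j y 0 j * mcoeff (mnm1 j) p = mcoeff (mnm1 i) p.
  rewrite (bigD1 i) //= mxE !eqxx mul1r big1 ?addr0 // => j ji.
  by rewrite mxE (negbTE ji) andbF mul0r.
rewrite -line_restr_coef1.
have -> : line_restr y p = line_restr y q * ((y *m l) 0 0 *: 'X).
  apply: poly_eq_horner => t; rewrite hornerM !line_restr_horner pql.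
  by rewrite hornerZ hornerX -scalemxAl mxE [t * _]mulrC.
rewrite -scalerAr coefZ coefMX /= -horner_coef0 line_restr_horner mulrC.
congr (_ * _); first by apply: meval_eq => j; rewrite scale0r mxE.
by rewrite /y -rowE mxE.
Qed.

End LinearPart.

(** The columns of [M] are a basis of the linear forms vanishing on the row space of [A]. The
    relations say that [A] stacked over [R] is inverse to [Q] placed beside [M]. *)
Lemma complement_matrices (K : fieldType) d n (A : 'M[K]_(d, n)) : row_free A ->
  exists r (M : 'M[K]_(n, r)) (R : 'M[K]_(r, n)) (Q : 'M[K]_(n, d)),
    [/\ (d + r = n)%N, A *m M = 0, R *m M = 1%:M &
        [/\ A *m Q = 1%:M, R *m Q = 0 & Q *m A + M *m R = 1%:M]].
Proof.
move=> freeA; have /row_freeP[Z AZ] := freeA.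
pose L := kermx A^T; pose M := (row_base L)^T.
have [B MB] : exists B, row_base L *m B = 1%:M by apply/row_freeP/row_base_free.
have AM : A *m M = 0.
  apply: trmx_inj; rewrite trmx_mul trmxK trmx0.
  by apply: sub_kermxP; rewrite eq_row_base.
have RM : B^T *m M = 1%:M by rewrite -trmx_mul MB trmx1.
have dn : (d <= n)%N by rewrite -(eqP freeA) rank_leq_col.
(* The right inverse [Z] of [A] is corrected by the projection 1 - M R to make R Q vanish. *)
exists (\rank L), M, B^T, ((1%:M - M *m B^T) *m Z); split=> //.
  by rewrite mxrank_ker mxrank_tr (eqP freeA) subnKC.
(* The projection is killed by [M], whose kernel contains the row space of [A] and has the same
   dimension [d]. *)
have ker_sub : (1%:M - M *m B^T <= A)%MS.
  have : ((1%:M - M *m B^T) *m M = 0).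
    by rewrite mulmxBl mul1mx -mulmxA RM mulmx1 subrr.
  move: (1%:M - _) => Y YM.
  have sAL : (A <= kermx M)%MS by apply/sub_kermxP.
  have rL : \rank (kermx M) = d.
    rewrite mxrank_ker mxrank_tr eq_row_base mxrank_ker mxrank_tr (eqP freeA).
    by rewrite subKn.
  have eqAL : (A == kermx M)%MS.
    by rewrite -(geq_leqif (mxrank_leqif_eq sAL)) rL (eqP freeA).
  by rewrite (eqmxP eqAL); apply/sub_kermxP.
split.
- by rewrite mulmxA mulmxBr mulmx1 mulmxA AM mul0mx subr0.
- by rewrite mulmxA mulmxBr mulmx1 mulmxA RM mul1mx subrr mul0mx.
- have /submxP[D DE] := ker_sub.
  by rewrite DE -[D *m A *m Z]mulmxA AZ mulmx1 -DE subrK.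
Qed.

(* The kernel of N is the graph of a linear map from the row space of A to that
   of R. *)
Lemma kernel_graph (K : fieldType) d n r (A : 'M[K]_(d, n)) (M : 'M[K]_(n, r))
    (R : 'M[K]_(r, n)) (Q : 'M[K]_(n, d)) (N : 'M[K]_(n, r)) :
  A *m Q = 1%:M -> R *m Q = 0 -> Q *m A + M *m R = 1%:M ->
  R *m N \in unitmx ->
  let S := A - A *m N *m invmx (R *m N) *m R in
  [/\ S *m N = 0, S *m Q = 1%:M &
      forall y : 'rV_n, y *m N = 0 -> y = y *m Q *m S].
Proof.
move=> AQ RQ QM uN S; split.
- by rewrite mulmxBl -[_ *m R *m N]mulmxA -[_ *m invmx _ *m _]mulmxA mulVmx //
    mulmx1 subrr.
- by rewrite mulmxBl AQ -[_ *m R *m Q]mulmxA RQ mulmx0 subr0.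
- move=> y yN.
  have yE : y = y *m Q *m A + y *m M *m R.
    by rewrite -!mulmxA -mulmxDr QM mulmx1.
  have yMN : y *m M = - (y *m Q *m A *m N *m invmx (R *m N)).
    have /(congr1 (mulmx^~ (invmx (R *m N)))) := yN.
    rewrite {1}yE mulmxDl -[y *m M *m R *m N]mulmxA mulmxDl mulmxK // mul0mx.
    by move/eqP; rewrite addrC addr_eq0 => /eqP.
  by rewrite {1}yE yMN mulNmx /S mulmxBr !mulmxA.
Qed.

(** * Linear equations of F and its local trivializations *)

Section LocalTriviality.
Variables (k : closedFieldType) (X : fspace k) (E : vfamily X) (n d : nat).
Variables (F : set E) (U : set X) (c : E -> 'rV[k]_n) (x0 : X).
Hypothesis ch : chart (vproj E) U c.
Hypothesis clin : forall x a (u v : vfibre E x) (p q r : E), U x ->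
  p = fibre_pt u -> q = fibre_pt v -> r = fibre_pt (a *: u + v) ->
  c r = a *: c p + c q.
Hypothesis closedF : closed F.
Hypothesis fibresF : forall x, fibre_subspace F x d.
Hypothesis Ux0 : U x0.

Let mpi : morphism (vproj E) := chart_morphism ch.
Let oU : open U := chart_open ch.

(** The coordinates are linear and injective on E_x, so they send a basis of F_x to independent
    rows. *)
Lemma fibre_matrix x : U x -> exists2 A : 'M[k]_(d, n), row_free A &
  forall e, vproj E e = x -> F e <-> (c e <= A)%MS.
Proof.
move=> Ux; have [V dimV VF] := fibresF x.
pose cx (u : vfibre E x) := c (fibre_pt u).
have cxL a u v : cx (a *: u + v) = a *: cx u + cx v.
  exact: (@clin x a u v _ _ _ Ux erefl erefl erefl).
have cx0 : cx 0 = 0.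
  have := cxL 1 0 0; rewrite !scale1r addr0 => /eqP.
  by rewrite -subr_eq0 opprD addrA subrr sub0r oppr_eq0 => /eqP.
have pi_fib (u : vfibre E x) : vproj E (fibre_pt u) = x.
  exact: (@set_val_in _ (vproj E @^-1` [set x]) u).
have cx_inj : injective cx.
  move=> u v cuv.
  have := chart_inj ch (e := fibre_pt u) (e' := fibre_pt v).
  rewrite !pi_fib => /(_ Ux erefl cuv) uv.
  exact: (@set_val_inj _ (vproj E @^-1` [set x]) u v uv).
have cx_sum m (w : 'I_m -> k) (b : 'I_m -> vfibre E x) :
    cx (\sum_i w i *: b i) = \sum_i w i *: cx (b i).
  elim/big_ind2: _ => // [|i _]; last by rewrite -[_ *: b i]addr0 cxL cx0 addr0.
  by move=> _ u _ v <- <-; rewrite -{1}[u]scale1r cxL scale1r.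
rewrite -dimV; pose bs := vbasis V.
have bsE (i : 'I_(\dim V)) : bs`_i \in V by apply/vbasis_mem/mem_nth; rewrite size_tuple.
pose A := \matrix_(i < \dim V) cx bs`_i.
have AE (w : 'rV_(\dim V)) : w *m A = cx (\sum_i w 0 i *: bs`_i).
  rewrite cx_sum; apply/rowP => j; rewrite mxE summxE.
  by apply: eq_bigr => i _; rewrite !mxE.
exists A.
  apply: inj_row_free => w; rewrite AE -cx0 => /cx_inj w0.
  apply/rowP => i; rewrite mxE.
  by have /freeP/(_ _ w0) := basis_free (vbasisP V); apply.
move=> e ex; have [u ue] : exists u : vfibre E x, fibre_pt u = e.
  exact: (@set_type_ex _ (vproj E @^-1` [set x]) e ex).
rewrite -ue; split=> [/VF uV|/submxP[w]].
  apply/submxP; exists (\row_i coord bs i u); rewrite AE.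
  congr (cx _); rewrite {1}(coord_vbasis uV).
  by apply: eq_bigr => i _; rewrite mxE.
rewrite AE => /cx_inj->; apply/VF/memv_suml => i _.
exact: memvZ.
Qed.

Hypothesis red : reduced_subscheme (scheme_inter F (vproj E @^-1` [set x0])).

Let vanishing_family (V : set X) (G : X -> mpoly n k) :=
  [/\ open V, V x0, V `<=` U, poly_family V G &
    forall e, F e -> V (vproj E e) -> fam_eval G (vproj E e) (c e) = 0].

(** Specialisations at [x0] of equations of [F] over neighbourhoods of [x0], rather than all
    polynomials vanishing on the points of the fibre; this ideal need not be radical a priori. *)
Let fibre_ideal (P : mpoly n k) :=
  exists V G, vanishing_family V G /\ G x0 = P.

Let fibre_idealP : is_ideal fibre_ideal.
Proof.
split.
- exists U, (fun=> 0); split=> //; split=> //; first exact: poly_family_cst.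
  by move=> e _ _; exact: meval0.
- move=> P Q [V [G [[oV Vx VU fG G0] <-]]] [W [H [[oW Wx WU fH H0] <-]]].
  exists (V `&` W), (fun x => G x + H x); split=> //; split=> //.
  + exact: openI.
  + by move=> x [/VU].
  + exact: poly_familyD.
  + by move=> e Fe [Ve We]; rewrite /fam_eval mevalD -!/(fam_eval _ _ _) G0 // H0 // addr0.
- move=> P Q [V [G [[oV Vx VU fG G0] <-]]].
  exists V, (fun x => P * G x); split=> //; split=> //.
  + by rewrite -[V]setIid; apply: poly_familyM => //; exact: poly_family_cst.
  + by move=> e Fe Ve; rewrite /fam_eval mevalM -/(fam_eval G _ _) G0 ?mulr0.
Qed.

(** A point off the closed set [F] has a basic neighbourhood disjoint from [F], on which some family
    [H] is nonzero. Then [H] vanishes on [F] but not at that point. *)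
Let fibre_ideal_zero v e : vproj E e = x0 -> (forall i, c e 0 i = v i) ->
  (forall P, fibre_ideal P -> meval v P = 0) -> F e.
Proof.
move=> ex ce vI; apply: contrapT => nFe.
have oNF := closed_openC closedF.
have Ue : U (vproj E e) by rewrite ex.
have [V [G [H [[oV Vx VU] fG fH H0 FE]]]] :=
  chart_presented ch oNF (regular_cst 0 oNF) nFe Ue.
have : meval v (H x0) = 0.
  apply: vI; exists V, H; split=> //; split=> //; first by rewrite -ex.
  move=> e' Fe' Ve'; apply/eqP/negPn/negP => /(FE e' Ve')[].
  by [].
move: H0; rewrite /fam_eval ex (meval_eq _ ce) => H0 H00.
by rewrite H00 eqxx in H0.
Qed.

Variable A : 'M[k]_(d, n).
Hypothesis AF : forall e, vproj E e = x0 -> F e <-> (c e <= A)%MS.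

(* The only use of reducedness: by the Nullstellensatz a power of the linear
   form l is the restriction to the fibre over x0 of a family vanishing on F;
   by reducedness the same holds for l itself near the origin, up to a
   nonvanishing factor. Since F is a cone, the linear part of that family still
   vanishes on F. *)
Lemma linear_family (l : 'cV[k]_n) : A *m l = 0 ->
  exists (V : set X) (N : X -> 'cV[k]_n) (h : k),
    [/\ [/\ open V, V x0 & V `<=` U],
        forall i, regular V (fun x => N x i 0), h != 0, N x0 = h *: l &
        forall e, F e -> V (vproj E e) -> c e *m N (vproj E e) = 0].
Proof.
move=> Al; pose lp := linear_poly l.
have [m [V [G [[oV Vx VU fG GF] Gx]]]] : exists m, fibre_ideal (lp ^+ m).
  apply: nullstellensatz fibre_idealP _ => v vI.
  have [e ex ce] := chart_surj ch (\row_i v i) Ux0.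
  have cev i : c e 0 i = v i by rewrite ce mxE.
  have /AF := fibre_ideal_zero ex cev vI.
  rewrite -(meval_eq _ cev) meval_linear_poly => /(_ ex)/submxP[w ->].
  by rewrite -mulmxA Al mulmx0 mxE.
pose W := vproj E @^-1` V; have oW : open W := morphism_open mpi oV.
pose f e := meval (fun i => c e 0 i) lp.
have rc j : regular W (fun e => c e 0 j).
  by apply: regular_sub (chart_coord ch j) => // z /VU.
have rf : regular W f by exact: regular_meval.
have rG := poly_family_regular mpi oV oW (@subset_refl _ _) rc fG.
have rfm := regularX m oW rf.
have /(red oW rf)[_ inter_f] :
    scheme_inter F (vproj E @^-1` [set x0]) W (fun e => f e ^+ m).
  (* The power is [G], which vanishes on [F], plus a difference that vanishes over [x0], where [G]
     specialises to the power of [lp]. *)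
  split=> // e We; exists W, (fun e => fam_eval G (vproj E e) (c e)).
  exists (fun e => f e ^+ m - fam_eval G (vproj E e) (c e)); split=> //.
    split; split=> //; first by move=> z Wz Fz; exact: GF.
      exact: regularB.
    by move=> z _ /= ->; rewrite /fam_eval Gx rmorphXn /= subrr.
  by move=> z _; rewrite addrC subrK.
(* The decomposition is taken at the zero vector over [x0], so that the denominator [H2] has a
   nonzero constant term there. *)
have [e0 e0x ce0] := chart_surj ch (0 : 'rV_n) Ux0.
have We0 : W e0 by rewrite /W /= e0x.
have [V1 [a [b [oV1 V1e0 V1W [[ra aF] [rb bx]] fab]]]] := inter_f e0 We0.
have Ue0 : U (vproj E e0) by rewrite e0x.
have [V2 [G2 [H2 [[oV2 V2x V2U] fG2 fH2 H20 aE]]]] :=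
  chart_presented ch oV1 ra V1e0 Ue0.
(* Multiplying by the denominator gives a family vanishing on [F] even where [H2] is zero; over [x0]
   it is the square of [H2] times [l]. *)
pose K x := G2 x * H2 x.
have fK : poly_family V2 K by rewrite -[V2]setIid; exact: poly_familyM.
rewrite e0x in V2x; rewrite e0x ce0 in H20.
have KF e : F e -> V2 (vproj E e) -> fam_eval K (vproj E e) (c e) = 0.
  move=> Fe Ve; rewrite /fam_eval mevalM -!/(fam_eval _ _ _).
  have [->|He] := eqVneq (fam_eval H2 (vproj E e) (c e)) 0; first by rewrite mulr0.
  have [V1e] := aE e Ve He; rewrite aF // => /esym/eqP.
  by rewrite mulf_eq0 invr_eq0 (negbTE He) orbF => /eqP->; rewrite mul0r.
have Kx0 (y : 'rV_n) : meval (fun i => y 0 i) (K x0) =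
    meval (fun i => y 0 i) (H2 x0 * H2 x0) * (y *m l) 0 0.
  rewrite [LHS]mevalM mevalM -mulrA [LHS]mulrC.
  have [->|H0] := eqVneq (meval (fun i => y 0 i) (H2 x0)) 0.
    by rewrite !mul0r.
  congr (_ * _); have [e ex ce] := chart_surj ch y Ux0.
  have := aE e; rewrite ex ce /fam_eval => /(_ V2x H0)[V1e ae].
  have := fab e V1e; rewrite (bx e V1e ex) addr0 ae.
  rewrite /f ce meval_linear_poly => ->.
  by rewrite mulrC divfK.
exists V2, (fun x => \col_i mcoeff (mnm1 i) (K x)).
exists (fam_eval H2 x0 0 ^+ 2); split=> //.
- move=> i; apply: eq_regular (poly_family_mcoeff (mnm1 i) oV2 fK) _ => // x _.
  by rewrite mxE.
- by rewrite expf_neq0.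
- apply/colP => i; rewrite !mxE (mcoeff1_mul_linear Kx0) mevalM.
  by congr (_ * _ * _); apply: meval_eq => j; rewrite mxE.
move=> e Fe Ve; apply/matrixP => i j; rewrite !ord1 !mxE.
under eq_bigr do rewrite mxE.
apply: vanish_linear_part => t; have Ue := V2U _ Ve.
have [B _ BF] := fibre_matrix Ue.
have [e' e'x ce'] := chart_surj ch (t *: c e) Ue.
rewrite -ce' -/(fam_eval K _ _) -e'x; apply: KF; last by rewrite e'x.
by apply/(BF _ e'x); rewrite ce' scalemx_sub //; apply/(BF e erefl).
Qed.

Hypothesis freeA : row_free A.

(** The columns of [N] come from [linear_family] applied to the columns of [M]. At [x0], [N] is [M]
    times an invertible diagonal matrix, so R N stays invertible nearby; there the kernel of [N] has
    dimension [d] and contains the fibre of [F], of the same dimension. *)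
Lemma kernel_family : exists r (V : set X) (N : X -> 'M[k]_(n, r))
    (M : 'M[k]_(n, r)) (R : 'M[k]_(r, n)) (Q : 'M[k]_(n, d)),
  [/\ [/\ open V, V x0 & V `<=` U],
      forall i j, regular V (fun x => N x i j),
      forall x, V x -> R *m N x \in unitmx,
      forall e, V (vproj E e) -> F e <-> c e *m N (vproj E e) = 0 &
      [/\ A *m Q = 1%:M, R *m Q = 0 & Q *m A + M *m R = 1%:M]].
Proof.
have [r [M [R [Q [dr AM RM AQ]]]]] := complement_matrices freeA.
have /choice[D DP] : forall j : 'I_r,
    exists D : set X * (X -> 'cV[k]_n) * k,
    [/\ [/\ open D.1.1, D.1.1 x0 & D.1.1 `<=` U],
        forall i, regular D.1.1 (fun x => D.1.2 x i 0), D.2 != 0,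
        D.1.2 x0 = D.2 *: col j M &
        forall e, F e -> D.1.1 (vproj E e) -> c e *m D.1.2 (vproj E e) = 0].
  move=> j; have [|V [N [h H]]] := @linear_family (col j M).
    by rewrite colE mulmxA AM mul0mx.
  by exists (V, N, h).
have [V0 [oV0 V0x V0D]] : exists V0, [/\ open V0, V0 x0 &
    forall j, V0 `<=` (D j).1.1].
  by apply: finite_open_inter => j; have [[]] := DP j.
pose V := U `&` V0; have oV : open V by exact: openI.
pose N x : 'M[k]_(n, r) := \matrix_(i, j) (D j).1.2 x i 0.
have rN i j : regular V (fun x => N x i j).
  have [_ /(_ i) rD _ _ _] := DP j.
  apply: (eq_regular (f := fun x => (D j).1.2 x i 0)) => // [|x _].
    by apply: regular_sub rD => // x [_ /V0D].
  by rewrite mxE.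
have rdet : regular V (fun x => \det (R *m N x)).
  by apply: regular_det => //; apply: regular_mulmx => // i j; exact: regular_cst.
have oW := regular_open oV rdet; set W := [set _ | _] in oW.
have FN e : F e -> V (vproj E e) -> c e *m N (vproj E e) = 0.
  move=> Fe [_ Ve]; apply/rowP => j; have [_ _ _ _ /(_ e Fe)] := DP j.
  move=> /(_ (V0D j _ Ve))/matrixP/(_ 0 0); rewrite !mxE => cD.
  by rewrite -[RHS]cD; apply: eq_bigr => i _; rewrite mxE.
exists r, W, N, M, R, Q; split=> //.
- split=> //; last by move=> x [[]].
  split=> //; have -> : N x0 = M *m diag_mx (\row_j (D j).2).
    rewrite mul_mx_diag; apply/matrixP => i j; rewrite !mxE.
    by have [_ _ _ -> _] := DP j; rewrite !mxE mulrC.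
  rewrite mulmxA RM mul1mx det_diag prodf_seq_neq0.
  by apply/allP => j _ /=; rewrite mxE; have [_ _ ->] := DP j.
- by move=> i j; apply: regular_sub (rN i j) => // x [].
- by move=> x [_]; rewrite unitmxE unitfE.
move=> e [Ve detN]; split=> [Fe|cN]; first exact: FN.
have [Ue _] := Ve; have [B freeB BF] := fibre_matrix Ue.
apply/(BF e erefl).
have sBN : (B <= kermx (N (vproj E e)))%MS.
  apply/sub_kermxP/row_matrixP => i; rewrite row_mul row0.
  have [e' e'x ce'] := chart_surj ch (row i B) Ue.
  rewrite -ce' -e'x FN ?e'x //.
  by apply/(BF _ e'x); rewrite ce' row_sub.
have rkN : \rank (N (vproj E e)) = r.
  apply/eqP; rewrite eqn_leq rank_leq_col /=.
  have /mxrank_unit {1}<- : R *m N (vproj E e) \in unitmx.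
    by rewrite unitmxE unitfE.
  exact: mxrankM_maxr.
have eqBN : (B == kermx (N (vproj E e)))%MS.
  rewrite -(geq_leqif (mxrank_leqif_eq sBN)) mxrank_ker rkN (eqP freeB).
  by rewrite -dr addnK.
by rewrite (eqmxP eqBN); apply/sub_kermxP.
Qed.

(** By [kernel_graph], multiplication by [Q] maps the kernel of [N] onto k^d with inverse the
    multiplication by [S], and the entries of [S] are regular. *)
Lemma local_trivialization : exists V, [/\ open V, V x0 &
  exists f : subsp (F `&` vproj E @^-1` V) ->
             prodsp (subsp V) (affine_space k d), trivialization f].
Proof.
have [r [V [N [M [R [Q [[oV Vx VU] rN uN FN [AQ RQ QM]]]]]]]] := kernel_family.
pose S x := A - A *m N x *m invmx (R *m N x) *m R.
have SP x : V x -> [/\ S x *m N x = 0, S x *m Q = 1%:M &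
    forall y : 'rV_n, y *m N x = 0 -> y = y *m Q *m S x].
  by move=> /uN; exact: kernel_graph QM.
have rcst a b (B : 'M[k]_(a, b)) i j : regular V (fun=> B i j).
  exact: regular_cst.
have rS i j : regular V (fun x => S x i j).
  have rRN := regular_mulmx oV (rcst _ _ R) rN.
  have det0 x : V x -> \det (R *m N x) != 0.
    by move=> /uN; rewrite unitmxE unitfE.
  have rT := regular_mulmx oV (regular_mulmx oV (regular_mulmx oV
    (rcst _ _ A) rN) (regular_invmx oV rRN det0)) (rcst _ _ R).
  apply: (eq_regular (f := fun x =>
    A i j - (A *m N x *m invmx (R *m N x) *m R) i j)) => //.
    exact: regularB.
  by move=> x _; rewrite !mxE.
pose T := F `&` vproj E @^-1` V.
have TF (t : T) : F (set_val t) by have [] := set_val_in t.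
have TV (t : T) : V (vproj E (set_val t)) by have [] := set_val_in t.
pose P := prodsp (subsp V) (affine_space k d).
pose f (t : subsp T) : P := (exist _ (vproj E (set_val t)) (mem_set (TV t)),
  c (set_val t) *m Q).
have f1 (t : T) : set_val (f t).1 = vproj E (set_val t) by [].
have /choice[g gP] : forall p : P, exists t : T,
    vproj E (set_val t) = set_val p.1 /\
    c (set_val t) = (p.2 : 'rV[k]_d) *m S (set_val p.1).
  move=> p; have Vp := set_val_in p.1; have [SN _ _] := SP _ Vp.
  have [e ex ce] := chart_surj ch ((p.2 : 'rV[k]_d) *m S (set_val p.1)) (VU _ Vp).
  have Te : T e.
    split; last by rewrite /= ex.
    by apply/FN; rewrite ex // ce -mulmxA SN mulmx0.
  by have [t te] := set_type_ex Te; exists t; rewrite te.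
have fK : cancel f g.
  move=> t; apply: set_val_inj; have [gpi gc] := gP (f t).
  apply: (chart_inj ch); first by rewrite gpi f1; exact/VU/TV.
    by rewrite gpi.
  rewrite gc f1 /=; have [_ _ /(_ (c (set_val t)))] := SP _ (TV t).
  by move=> /(_ ((FN _ (TV t)).1 (TF t))) <-.
have gK : cancel g f.
  move=> p; have [gpi gc] := gP p; have [_ SQ _] := SP _ (set_val_in p.1).
  rewrite [p in RHS]surjective_pairing /f; congr (_, _).
    by apply: set_val_inj.
  by rewrite gc -mulmxA SQ mulmx1.
have msT := @morphism_set_val _ _ T.
have mpiT : morphism (vproj E \o (set_val : subsp T -> E)).
  exact: morphism_comp.
have mf : morphism f.
  apply: morphism_into_prod => //= j.
  have rc i : regular (setT : set (subsp T)) (fun t => c (set_val t) 0 i).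
    have := msT.2 _ _ (morphism_open mpi oU) (chart_coord ch i).
    by apply: regular_sub => [|t _]; [exact: openT|exact/VU/TV].
  apply: (eq_regular (f := fun t : subsp T =>
    \sum_i c (set_val t) 0 i * Q i j)); first exact: openT.
    apply: regular_sum => [|i _]; first exact: openT.
    by apply: regularM => //; [exact: openT|apply: regular_cst; exact: openT].
  by move=> t _; rewrite mxE.
have mfst : morphism ((fun p => set_val p.1) : P -> X).
  exact: (morphism_comp (@morphism_fst _ _ _) (@morphism_set_val _ _ V)).
have mg : @morphism k P (subsp T) g.
  apply: morphism_into_subsp; apply: (chart_lift ch).
  - by move=> p /=; exact/VU/TV.
  - rewrite (_ : _ \o _ = fun p => set_val p.1) //.
    by apply/funext => p /=; have [] := gP p.
  - move=> j; have oT : open (setT : set P) by exact: openT.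
    apply: (eq_regular (f := fun p : P =>
      \sum_i (p.2 : 'rV[k]_d) 0 i * S (set_val p.1) i j)) => //; last first.
      by move=> p _ /=; have [_ ->] := gP p; rewrite mxE.
    apply: regular_sum => // i _; apply: regularM => //.
      exact: prodsp_coord_regular.
    have := mfst.2 V _ oV (rS i j).
    by apply: regular_sub => // p _; exact: set_val_in p.1.
exists V; split=> //; exists f; split=> //.
  by split=> //; exists g.
move=> x a u v p q s pu qv sE /=.
have Ux : U x.
  have <- : vproj E (fibre_pt u) = x.
    exact: (@set_val_in _ (vproj E @^-1` [set x]) u).
  by rewrite -pu; exact/VU/TV.
by rewrite (@clin x a u v _ _ _ Ux pu qv sE) mulmxDl scalemxAl.
Qed.

End LocalTriviality.

(** * The two implications for a bundle *)

Section Proposition.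
Variables (k : closedFieldType) (X : fspace k) (n : nat) (E : vfamily X).
Variables (F : set E) (d : nat).
Hypothesis varX : variety X.
Hypothesis bundleE : vector_bundle n E.

Let closed1 (x : X) : closed [set x].
Proof. by apply: separated_closed1; case: varX. Qed.

Lemma bundle_chart x : exists2 U : set X, U x &
  exists2 c : E -> 'rV[k]_n, chart (vproj E) U c &
    forall x a (u v : vfibre E x) (p q r : E), U x ->
      p = fibre_pt u -> q = fibre_pt v -> r = fibre_pt (a *: u + v) ->
      c r = a *: c p + c q.
Proof.
have [_ mpi _ /(_ x)[U [oU Ux [f trf]]]] := bundleE.
exists U => //.
have := trivialization_chart (i := id) oU mpi (@embedding_id _ _) _ trf.
by apply=> e; split=> [Ue|[]//]; split=> //; exists e.
Qed.

Hypothesis closedF : closed F.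

(** A chart of [E] supplies through [chart_vanish] the generation of the ideal of E_x by functions
    vanishing at [x]. *)
Lemma bundle_reduced_inter_fibre x :
  reduced_subscheme (scheme_inter F (vproj E @^-1` [set x])) <->
  reduced_subscheme (scheme_fibre (restr_proj F) x).
Proof.
have [U Ux [c ch _]] := bundle_chart x.
apply: reduced_inter_fibre => //; first exact: chart_morphism ch.
by move=> V b oV rb; exact: chart_vanish ch Ux _ oV rb.
Qed.

(** A local trivialization of [F] is a chart of [F] as a space of its own, to which
    [chart_fibre_reduced] applies. *)
Lemma sub_bundle_reduced_fibre x :
  sub_bundle F -> reduced_subscheme (scheme_fibre (restr_proj F) x).
Proof.
have [_ mpi _ _] := bundleE.
move=> [_ _ /(_ x)[U [e [oU Ux [f trf]]]]].
have [|c ch _] := trivialization_chart (i := set_val : subsp F -> E) oU mpi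
  (@embedding_set_val _ _ F) _ trf.
  move=> z; split=> [[Fz Uz]|[[y <-] Uz]].
    by have [y yz] := set_type_ex Fz; split=> //; exists y.
  by split=> //; exact: set_val_in.
exact: chart_fibre_reduced ch Ux _.
Qed.

Hypothesis fibresF : forall x, fibre_subspace F x d.

Lemma reduced_inter_sub_bundle :
  (forall x, reduced_subscheme (scheme_inter F (vproj E @^-1` [set x]))) ->
  sub_bundle F.
Proof.
move=> red; split=> // [x|x]; first by exists d.
have [U Ux [c ch clin]] := bundle_chart x.
have [A freeA AF] := fibre_matrix ch clin fibresF Ux.
have [V [oV Vx trV]] :=
  local_trivialization ch clin closedF fibresF Ux (red x) AF freeA.
by exists V, d.
Qed.

End Proposition.

Theorem proposition2 (k : closedFieldType) (X : fspace k) (n : nat)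
    (E : vfamily X) (F : set E) (d : nat)
    (varX : variety X) (connX : connected [set: X])
    (bundleE : vector_bundle n E)
    (closedF : closed F)
    (fibresF : forall x : X, fibre_subspace F x d) :
  (sub_bundle F <->
     forall x : X,
       reduced_subscheme (scheme_inter F (vproj E @^-1` [set x]))) /\
  (sub_bundle F <->
     forall x : X,
       reduced_subscheme (scheme_fibre (restr_proj F) x)).
Proof.
have fwd : sub_bundle F ->
    forall x, reduced_subscheme (scheme_fibre (restr_proj F) x).
  by move=> sF x; exact: (sub_bundle_reduced_fibre varX bundleE).
have inter_fibre x := bundle_reduced_inter_fibre varX bundleE closedF x.
have bwd := reduced_inter_sub_bundle bundleE closedF fibresF.
split; split=> //; first by move=> /fwd red x; exact/inter_fibre.
by move=> red; apply: bwd => x; exact/inter_fibre.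
Qed.
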